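(* There is a constant $C_4>0$ such that for every bounded Borel function $b:\mathbb{R}\to\mathbb{R}$ and all $t>0$, $$|J_5|\le C_4\,\|b\|_\infty^4\,t^2,$$ where $$J_5=\int_0^t ds_1\int_{s_1}^t ds_2\int_{s_2}^t ds_3\int_{s_3}^t ds_4\Bigl[\int_{\mathbb{R}^4}b(y_1)b(y_2)b(y_3)b(y_4)\,q_{s_1}(y_1)\,q''_{s_2-s_1}(y_2-y_1)\,q_{s_3-s_2}(y_3-y_2)\,q''_{s_4-s_3}(y_4-y_3)\,dy_1\,dy_2\,dy_3\,dy_4\Bigr].$$
   Context: $q_t(x)=\frac{e^{-x^2/(2t)}}{\sqrt{2\pi t}}$ for $t>0$, $x\in\mathbb{R}$, is the heat kernel and $q_t''$ is its second derivative with respect to $x$. The time integrals are iterated integrals in the order written, $ds_4$ innermost; singularities of the integrand at $s_4=s_3$ and $s_2=s_1$ are understood as limits of the integrals over $s_4-s_3>\varepsilon$, respectively $s_2-s_1>\varepsilon$, as $\varepsilon\to0$. *)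

(* Defs.v *)
From HB Require Import structures.
From mathcomp Require Import all_boot all_order all_algebra.
From mathcomp Require Import all_classical all_reals all_analysis.

Set Implicit Arguments.
Unset Strict Implicit.
Unset Printing Implicit Defensive.
Import Order.TTheory GRing.Theory Num.Theory.
Import numFieldNormedType.Exports.

Local Open Scope classical_set_scope.
Local Open Scope ring_scope.

Definition heat_kernel (R : realType) (t x : R) : R :=
  expR (- x ^+ 2 / (2 * t)) / Num.sqrt (2 * pi * t).

Definition heat_kernel'' (R : realType) (t : R) : R -> R :=
  ((heat_kernel t)^`(2))%classic.

(* Supremum of |b|, not the essential supremum; [sup] returns a junk value
   unless b is bounded. *)
Definition sup_norm (R : realType) (b : R -> R) : R :=
  sup (range (fun x => `|b x|)).

Definition lebesgue_measure4 (R : realType) :=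
  (((@lebesgue_measure R \x @lebesgue_measure R)
      \x @lebesgue_measure R) \x @lebesgue_measure R)%E.
Arguments lebesgue_measure4 R : clear implicits.

(* Integrals over an interval are taken over its interior: the endpoints are
   null, and there a heat kernel would be evaluated at time 0. *)
Definition interval_integral (R : realType) (f : R -> R) (a c : R) : R :=
  \int[@lebesgue_measure R]_(s in `]a, c[) f s.

Definition interval_integrable (R : realType) (f : R -> R) (a c : R) : Prop :=
  (@lebesgue_measure R).-integrable `]a, c[ (EFin \o f).

Definition improper_integral (R : realType) (f : R -> R) (a c : R) : R :=
  lim (interval_integral f (a + e) c @[e --> 0^'+]).

(* Needed because [lim] and the integral are total operators. *)
Definition improper_integrable (R : realType) (f : R -> R) (a c : R) : Prop :=
  (forall e : R, 0 < e -> interval_integrable f (a + e) c) /\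
  cvg (interval_integral f (a + e) c @[e --> 0^'+]).

Section J5.
Variables (R : realType) (b : R -> R) (t : R).

Definition J5_integrand (s1 s2 s3 s4 : R) (y : R * R * R * R) : R :=
  let: (y1, y2, y3, y4) := y in
  b y1 * b y2 * b y3 * b y4 *
  heat_kernel s1 y1 * heat_kernel'' (s2 - s1) (y2 - y1) *
  heat_kernel (s3 - s2) (y3 - y2) * heat_kernel'' (s4 - s3) (y4 - y3).

Definition J5_space (s1 s2 s3 s4 : R) : R :=
  \int[lebesgue_measure4 R]_y J5_integrand s1 s2 s3 s4 y.

Definition J5_ds4 (s1 s2 s3 : R) : R :=
  improper_integral (J5_space s1 s2 s3) s3 t.

Definition J5_ds3 (s1 s2 : R) : R := interval_integral (J5_ds4 s1 s2) s2 t.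

Definition J5_ds2 (s1 : R) : R := improper_integral (J5_ds3 s1) s1 t.

Definition J5 : R := interval_integral J5_ds2 0 t.

(* Every integral and every limit occurring in J5 exists. *)
Definition J5_well_defined : Prop :=
  [/\ forall s1 s2 s3 s4 : R, 0 < s1 -> s1 < s2 -> s2 < s3 -> s3 < s4 ->
        s4 < t ->
        (lebesgue_measure4 R).-integrable setT
          (EFin \o J5_integrand s1 s2 s3 s4),
      forall s1 s2 s3 : R, 0 < s1 -> s1 < s2 -> s2 < s3 -> s3 < t ->
        improper_integrable (J5_space s1 s2 s3) s3 t,
      forall s1 s2 : R, 0 < s1 -> s1 < s2 -> s2 < t ->
        interval_integrable (J5_ds4 s1 s2) s2 t,
      forall s1 : R, 0 < s1 -> s1 < t ->
        improper_integrable (J5_ds3 s1) s1 t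
    & interval_integrable J5_ds2 0 t].

End J5.

(* Main.v *)
Require Import Defs.
From HB Require Import structures.
From mathcomp Require Import all_boot all_order all_algebra.
From mathcomp Require Import all_classical all_reals all_analysis.
From mathcomp Require Import measurable_realfun ring lra.

Set Implicit Arguments.
Unset Strict Implicit.
Unset Printing Implicit Defensive.
Import Order.TTheory GRing.Theory Num.Theory.
Import numFieldNormedType.Exports.

Local Open Scope classical_set_scope.
Local Open Scope ring_scope.

(** At time [u] the second derivative of the heat kernel has mass of order
    [1 / u], which is not integrable at [u = 0]: estimating absolute values
    makes the integral diverge logarithmically at [s4 = s3] and at [s2 = s1].
    The cancellation comes from the heat equation, which says that the second
    space derivative is twice the time derivative, so that a second derivative
    integrated in time against a time-independent function gives a difference
    of two bounded averages.

    Write [q] for the heat kernel, [q2] for its second derivative in space,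
    [T_k phi x] for the integral of [phi y * k (y - x)] in [y] ([kconv]) and
    [M] for a bound of [b].  The space integral is computed from [y4] down to
    [y1]: each variable is integrated out by applying some [T_k]
    ([backward_step_integral]), and [J5_space s1 s2 s3 s4] becomes the
    integral of an integrable weight in [y1, y2, y3] against
    [T_{q2 (s4 - s3)} b] at [y3].

    The integral over [s4 > s3 + e] of [T_{q2 (s4 - s3)} b] is
    [2 (T_{q (t - s3)} b - T_{q e} b)], and [T_{q e} b] tends to [b] at every
    Lebesgue point of [b], hence almost everywhere ([heat_initial_ae]).  By
    dominated convergence the improper integral exists ([improper_cvg_heat2]),
    and the two innermost integrals leave behind the bounded source
    [g_s3 = 2 b (T_{q (t - s3)} b - b)] ([inner_source]).

    Integrating in [s3] gives the function [H_s], the integral over [r] in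
    [(s, t)] of [T_{q (r - s)} g_r] ([tail_profile]), of size [4 M^2 (t - s)],
    and [J5_ds3 s1 s2] is the integral of [b q_s1 T_{q2 (s2 - s1)} (b H_s2)].
    Now the function under [q2] depends on the time [s2] of integration.
    Split it as [b H_s1 + b (H_s2 - H_s1)].  The first term is independent of
    [s2] and is treated as before ([initial_part]).  For the second,
    [q c - q a] has mass at most [18 sqrt ((c - a) / a)] for [a < c]
    ([L1_kernel_heat_diff]), so that [H] is 1/2-Hoelder in time uniformly in
    space ([tail_profile_holder]), and the singularity [1 / (s2 - s1)] improves
    to the integrable [1 / sqrt (s2 - s1)] ([increment_le]).  Both terms are
    of size [M^4 t], and the integral in [s1] contributes the last factor [t].

    The same formulas give the existence of all the integrals: the functions
    of time that occur are integrals of jointly measurable functions, hence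
    measurable, and the bounds make them integrable. *)

(** * Real-valued dominated integrals and Fubini's theorem *)

Section dominated_real_integrals.
Context d (T : measurableType d) (R : realType).
Variable mu : {measure set T -> \bar R}.
Implicit Types (D : set T) (f g : T -> R).

Lemma dominated_integrable D f g : measurable D -> measurable_fun D f ->
    (forall x, D x -> `|f x| <= g x) -> mu.-integrable D (EFin \o g) ->
  mu.-integrable D (EFin \o f).
Proof.
move=> mD mf fg ig; apply: le_integrable ig => //.
  exact/measurable_EFinP.
by move=> x Dx /=; rewrite lee_fin (le_trans (fg _ Dx))// ler_norm.
Qed.

Lemma normr_Rintegral_le D f g : measurable D -> measurable_fun D f ->
    (forall x, D x -> `|f x| <= g x) -> mu.-integrable D (EFin \o g) ->
  `|\int[mu]_(x in D) f x| <= \int[mu]_(x in D) g x.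
Proof.
move=> mD mf fg ig; have fi := dominated_integrable mD mf fg ig.
apply: le_trans (le_normr_Rintegral mD fi) _.
apply: le_Rintegral => //; exact: integrable_norm.
Qed.

Lemma integrable_scaled f g (c : R) : measurable_fun setT f ->
    (forall x, `|f x| <= c) -> mu.-integrable setT (EFin \o g) ->
  mu.-integrable setT (EFin \o (fun x => g x * f x)).
Proof.
move=> mf fc gi.
have mg : measurable_fun setT g by apply/measurable_EFinP; exact: measurable_int gi.
apply: (@dominated_integrable _ _ (fun x => c * `|g x|)) => //.
- exact: measurable_funM.
- by move=> x _; rewrite normrM mulrC ler_wpM2r.
- have := integrableZl measurableT c (integrable_norm gi).
  by apply: eq_integrable.
Qed.

End dominated_real_integrals.

Section real_fubini.
Context d1 d2 (T1 : measurableType d1) (T2 : measurableType d2) (R : realType).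
Variable m1 : {sigma_finite_measure set T1 -> \bar R}.
Variable m2 : {sigma_finite_measure set T2 -> \bar R}.
Implicit Types f : T1 * T2 -> R.

(** The real-valued integral is [fine] of the difference of the integrals of
    the positive and negative parts, and both are measurable in [x] by
    Tonelli's theorem. *)
Lemma measurable_Rintegral_snd f : measurable_fun setT f ->
  measurable_fun setT (fun x => \int[m2]_y f (x, y)).
Proof.
move=> mf; have mEf : measurable_fun setT (EFin \o f) by exact/measurable_EFinP.
apply: (measurableT_comp (fine_measurable measurableT)).
rewrite [X in measurable_fun _ X](_ : _ =
   (fun x => \int[m2]_y ((EFin \o f)^\+ (x, y)))%E \-
   (fun x => \int[m2]_y ((EFin \o f)^\- (x, y)))%E)%E; last first.
  apply/funext => x; rewrite [LHS]integralE.
  by congr (_ - _)%E; apply: eq_integral => y _; rewrite ?funeposE ?funenegE.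
apply: emeasurable_funB; apply: measurable_fun_fubini_tonelli_F => //.
- exact: measurable_funepos.
- exact: measurable_funeneg.
Qed.

Lemma integrable_prod_fst f (g : T1 -> R) : measurable_fun setT f ->
    (forall x, m2.-integrable setT (EFin \o (fun y => f (x, y)))) ->
    (forall x, \int[m2]_y `|f (x, y)| <= g x) ->
    m1.-integrable setT (EFin \o g) ->
  (m1 \x m2)%E.-integrable setT (EFin \o f).
Proof.
move=> mf fi fg gi; apply/integrable12ltyP; first exact/measurable_EFinP.
have gil : (\int[m1]_x (EFin \o g) x < +oo)%E by apply: integrable_lty.
apply: le_lt_trans gil; apply: ge0_le_integral => //.
- by move=> x _; apply: integral_ge0.
- have := @measurable_fun_fubini_tonelli_F _ _ _ _ _ m2 (fun z => `|(f z)%:E|%E).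
  apply => //; apply: measurableT_comp => //; exact/measurable_EFinP.
- exact: measurable_int gi.
- move=> x _; rewrite [leLHS](_ : _ = (\int[m2]_y `|f (x, y)|)%:E) ?lee_fin//.
  rewrite /Rintegral fineK//; apply: integrable_fin_num => //.
  exact: integrable_norm (fi x).
Qed.

Variable f : T1 * T2 -> R.
Hypothesis fi : (m1 \x m2)%E.-integrable setT (EFin \o f).

(** The inner extended-real integral may be infinite, but only on a null set;
    elsewhere [fine] is harmless. *)
Lemma Rintegral_prod_fst :
  \int[(m1 \x m2)%E]_z f z = \int[m1]_x \int[m2]_y f (x, y).
Proof.
rewrite /Rintegral -(integral12_prod_meas1 fi).
congr fine; apply: ae_eq_integral => //.
- exact: (measurable_fubini_F fi).
- apply/measurable_EFinP; apply: measurable_Rintegral_snd.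
  by apply/measurable_EFinP; exact: measurable_int fi.
- have := ae_integrable1 fi; apply: filterS => x /= h _.
  by rewrite fineK// integrable_fin_num.
Qed.

Lemma Rintegral_prod_snd :
  \int[(m1 \x m2)%E]_z f z = \int[m2]_y \int[m1]_x f (x, y).
Proof.
have mf : measurable_fun setT f by apply/measurable_EFinP; exact: measurable_int fi.
rewrite /Rintegral -(integral21_prod_meas1 fi).
congr fine; apply: ae_eq_integral => //.
- exact: (measurable_fubini_G fi).
- apply/measurable_EFinP; apply: (measurableT_comp (fine_measurable measurableT)).
  exact: (measurable_fubini_G fi).
- have := ae_integrable2 fi; apply: filterS => x /= h _.
  by rewrite fineK// integrable_fin_num.
Qed.

Lemma Rintegral_swap :
  \int[m1]_x \int[m2]_y f (x, y) = \int[m2]_y \int[m1]_x f (x, y).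
Proof. by rewrite -Rintegral_prod_fst Rintegral_prod_snd. Qed.

End real_fubini.

Section sigma_finite_product.
Context d1 d2 (T1 : measurableType d1) (T2 : measurableType d2) (R : realType).
Variable m1 : {sigma_finite_measure set T1 -> \bar R}.
Variable m2 : {sigma_finite_measure set T2 -> \bar R}.

(** The product measure under a name of its own, which carries the
    sigma-finite structure; iterated products can then be formed. *)
Definition sigma_finite_product : set (T1 * T2) -> \bar R := (m1 \x m2)%E.

HB.instance Definition _ := Measure.on sigma_finite_product.

Lemma sigma_finite_productP : sigma_finite setT sigma_finite_product.
Proof.
have /sigma_finiteP[F [FT Fnd Ffin]] := sigma_finiteT m1.
have /sigma_finiteP[G [GT Gnd Gfin]] := sigma_finiteT m2.
exists (fun n => F n `*` G n).
  apply/esym; rewrite -subTset => -[x y] _.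
  have [n _ Fx] : (\bigcup_n F n) x by rewrite -FT.
  have [k _ Gy] : (\bigcup_n G n) y by rewrite -GT.
  exists (maxn n k) => //; split => /=.
    by move: x Fx; exact/subsetPset/Fnd/leq_maxl.
  by move: y Gy; exact/subsetPset/Gnd/leq_maxr.
move=> k; have [mF Fk] := Ffin k; have [mG Gk] := Gfin k.
split; first exact: measurableX.
rewrite [X in (X < _)%E](product_measure1E _ _ mF mG).
by rewrite lte_mul_pinfty// ge0_fin_numE.
Qed.

HB.instance Definition _ := Measure_isSigmaFinite.Build _ _ _
  sigma_finite_product sigma_finite_productP.

End sigma_finite_product.

Lemma measurable_comp2 d (T : measurableType d) (R : realType) (F : R -> R -> R)
    (f g : T -> R) :
  measurable_fun setT (fun z : R * R => F z.1 z.2) ->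
  measurable_fun setT f -> measurable_fun setT g ->
  measurable_fun setT (fun x => F (f x) (g x)).
Proof.
move=> mF mf mg.
apply: (measurableT_comp mF (_ : measurable_fun setT (fun x => (f x, g x)))).
exact: measurable_fun_pair.
Qed.

(** * The heat kernel and its derivatives *)

Lemma measurable_invr (R : realType) : measurable_fun setT (@GRing.inv R).
Proof.
rewrite -(setUv [set (0 : R)]); apply/measurable_funU => //; first exact: measurableC.
split.
  move=> _ Y mY; have [Y0|Y0] := pselect (Y 0).
    rewrite [X in measurable X](_ : _ = [set 0])//.
    by apply/seteqP; split=> x /= [->]; rewrite ?invr0.
  rewrite [X in measurable X](_ : _ = set0)//.
  by apply/seteqP; split=> x //= [->]; rewrite ?invr0.
apply: open_continuous_measurable_fun.
  exact/closed_openC/closed_eq.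
by move=> x /set_mem /= /eqP x0; exact: inv_continuous.
Qed.

Lemma measurable_sqrt (R : realType) : measurable_fun setT (@Num.sqrt R).
Proof. by apply: continuous_measurable_fun; exact: sqrt_continuous. Qed.

Section heat_kernel.
Variable R : realType.
Local Notation mu := (@lebesgue_measure R).
Local Notation q := (@heat_kernel R).

Lemma measurable_heat_kernel : measurable_fun setT (fun z : R * R => q z.1 z.2).
Proof.
apply: measurable_funM.
  apply: measurableT_comp => //; apply: measurable_funM.
    by apply: measurableT_comp => //; apply: measurable_funX.
  by apply: (measurableT_comp (@measurable_invr R)); apply: measurable_funM.
apply: (measurableT_comp (@measurable_invr R)).
by apply: (measurableT_comp (@measurable_sqrt R)); apply: measurable_funM.
Qed.

Lemma heat_kernel_ge0 t x : 0 <= q t x.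
Proof. by rewrite /heat_kernel divr_ge0 ?expR_ge0// sqrtr_ge0. Qed.

Lemma heat_kernel_le0 t x : t <= 0 -> q t x = 0.
Proof.
move=> t0; rewrite /heat_kernel ler0_sqrtr ?invr0 ?mulr0//.
by rewrite mulr_ge0_le0// mulr_ge0// pi_ge0.
Qed.

Lemma heat_kernel_pdf t x y : 0 < t -> q t (y - x) = normal_pdf x (Num.sqrt t) y.
Proof.
move=> t0; have s0 : Num.sqrt t != 0 by rewrite gt_eqF// sqrtr_gt0.
rewrite normal_pdfE// /normal_peak /normal_fun /heat_kernel sqr_sqrtr ?ltW// mulrC.
congr (_ * expR _); last by rewrite mulr_natl.
by congr (Num.sqrt _)^-1; rewrite -mulr_natl; ring.
Qed.

Lemma integrable_heat_kernel t x : mu.-integrable setT (EFin \o (fun y => q t (y - x))).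
Proof.
have [t0|t0] := ltP 0 t.
  apply: eq_integrable (integrable_normal_pdf x (Num.sqrt t)) => //.
  by move=> y _ /=; rewrite heat_kernel_pdf.
apply: eq_integrable (integrable0 _ _) => //.
by move=> y _ /=; rewrite heat_kernel_le0.
Qed.

Lemma Rintegral_heat_kernel t x : 0 < t -> \int[mu]_y q t (y - x) = 1.
Proof.
move=> t0; rewrite /Rintegral -[RHS]/(fine 1%E) -(integral_normal_pdf x (Num.sqrt t)).
by congr fine; apply: eq_integral => y _; rewrite heat_kernel_pdf.
Qed.

Lemma Rintegral_heat_kernel_le1 t x : \int[mu]_y q t (y - x) <= 1.
Proof.
have [t0|t0] := ltP 0 t; first by rewrite Rintegral_heat_kernel.
rewrite (@eq_Rintegral _ _ _ _ _ (cst 0)) ?Rintegral_cst ?mul0r//.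
by move=> y _; rewrite heat_kernel_le0.
Qed.

(** The second space derivative for positive times.  The closed formula is
    zero for nonpositive times, because the heat kernel is, and it is jointly
    measurable in time and space. *)
Definition heat_kernel2 (t x : R) := (x ^+ 2 / t ^+ 2 - t^-1) * q t x.
Local Notation q2 := heat_kernel2.

Lemma measurable_heat_kernel2 : measurable_fun setT (fun z : R * R => q2 z.1 z.2).
Proof.
apply: measurable_funM; last exact: measurable_heat_kernel.
apply: measurable_funB; last exact: (measurableT_comp (@measurable_invr R)).
apply: measurable_funM; first exact: measurable_funX.
by apply: (measurableT_comp (@measurable_invr R)); apply: measurable_funX.
Qed.

Lemma is_derive_heat_kernel_space (t x : R) : 0 < t ->
  is_derive x (1 : R) (q t) (- (x / t) * q t x).
Proof.
move=> t0.
have dg : is_derive x (1 : R) (fun y : R => - (2 * t)^-1 *: y ^+ 2) (- (x / t)).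
  apply: is_derive_eq; rewrite /GRing.scale/=.
  by field; rewrite gt_eqF.
have de := is_derive1_comp (is_derive_expR _) dg.
have qE : q t = (fun y => (Num.sqrt (2 * pi * t))^-1 *: expR (- (2 * t)^-1 *: y ^+ 2)).
  by apply/funext => y; rewrite /heat_kernel /GRing.scale/= mulrC; congr (_ * expR _); ring.
rewrite qE; apply: (is_derive_eq (is_deriveZ (Num.sqrt (2 * pi * t))^-1 de)).
by rewrite /GRing.scale/=; ring.
Qed.

Lemma is_derive_heat_kernel_space2 (t x : R) : 0 < t ->
  is_derive x (1 : R) (fun y => - (y / t) * q t y) (q2 t x).
Proof.
move=> t0; have dq := is_derive_heat_kernel_space x t0.
have dl : is_derive x (1 : R) (fun y : R => - t^-1 *: y) (- t^-1).
  by apply: is_derive_eq; rewrite /GRing.scale/= mulr1.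
have qE : (fun y => - (y / t) * q t y) = (fun y => (- t^-1 *: y) * q t y).
  by apply/funext => y; rewrite /GRing.scale/=; ring.
rewrite qE; apply: (is_derive_eq (is_deriveM dl dq)).
by rewrite /heat_kernel2 /GRing.scale/=; field; rewrite gt_eqF.
Qed.

Lemma heat_kernel''E (t : R) : 0 < t -> heat_kernel'' t = q2 t.
Proof.
move=> t0; apply/funext => x; rewrite /heat_kernel'' derive1nS derive1n1.
have -> : (q t)^`()%classic = (fun y => - (y / t) * q t y).
  by apply/funext => y; rewrite derive1E; apply: derive_val; exact: is_derive_heat_kernel_space.
by rewrite derive1E; apply: derive_val; exact: is_derive_heat_kernel_space2.
Qed.

(** The heat equation; it is what turns time integrals of the second space
    derivative into differences of heat kernels. *)
Lemma is_derive_heat_kernel_time (t x : R) : 0 < t ->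
  is_derive t (1 : R) (q^~ x) (2^-1 * q2 t x).
Proof.
move=> t0.
have tn : t != 0 by rewrite gt_eqF.
have s0 : 0 < Num.sqrt (2 * pi * t) by rewrite sqrtr_gt0 !mulr_gt0 ?pi_gt0.
have dg : is_derive t (1 : R) (fun u : R => - (x ^+ 2 / 2) *: u^-1) (x ^+ 2 / (2 * t ^+ 2)).
  have dv := is_deriveV tn (is_derive_id t (1:R)).
  apply: (is_derive_eq (is_deriveZ (- (x ^+ 2 / 2)) dv)).
  by rewrite /GRing.scale/=; field.
have de := is_derive1_comp (is_derive_expR _) dg.
have dl : is_derive t (1 : R) (fun u : R => (2 * pi) *: u) (2 * pi).
  by apply: is_derive_eq; rewrite /GRing.scale/= mulr1.
have ps : 0 < (2 * pi) *: t by rewrite /GRing.scale/= !mulr_gt0 ?pi_gt0.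
have ds := is_derive1_comp (is_derive1_sqrt ps) dl.
have sn : (Num.sqrt \o (fun u : R => (2 * pi) *: u)) t != 0 by rewrite /= gt_eqF.
have dS := is_deriveV sn ds.
have qE : q^~ x = (fun u => expR (- (x ^+ 2 / 2) *: u^-1) * (Num.sqrt ((2 * pi) *: u))^-1).
  apply/funext => u; rewrite /GRing.scale/= /heat_kernel.
  by congr (expR _ / _); rewrite invfM; ring.
rewrite qE; apply: (is_derive_eq (is_deriveM de dS)).
rewrite /heat_kernel2 /heat_kernel /GRing.scale/=.
have <- : - (x ^+ 2 / 2) * t^-1 = - x ^+ 2 / (2 * t) by field.
have sE : Num.sqrt (2 * pi * t) ^+ 2 = 2 * pi * t by rewrite sqr_sqrtr// ltW.
have sn' : Num.sqrt (2 * pi * t) != 0 by rewrite gt_eqF.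
set e := expR _; set S := Num.sqrt _.
have pn : pi != 0 :> R by rewrite gt_eqF// pi_gt0.
rewrite -/S in sE sn'.
have -> : S ^- 2 = (2 * pi * t)^-1 by rewrite sE.
clear sE; clearbody S; move: pi pn => P pn.
by field; rewrite tn pn sn'.
Qed.

End heat_kernel.

(** * Pointwise bounds on the heat kernel *)

Section heat_kernel_bounds.
Variable R : realType.
Local Notation mu := (@lebesgue_measure R).
Local Notation q := (@heat_kernel R).
Local Notation q2 := (@heat_kernel2 R).

Lemma heat_kernel_le_later (u v x : R) : 0 < u -> u <= v ->
  q u x <= Num.sqrt (v / u) * q v x.
Proof.
move=> u0 uv; have v0 := lt_le_trans u0 uv.
rewrite /heat_kernel.
have -> : Num.sqrt (2 * pi * v) = Num.sqrt (v / u) * Num.sqrt (2 * pi * u).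
  rewrite -sqrtrM ?divr_ge0 ?ltW//; congr Num.sqrt.
  by move: (pi : R) => P; field; rewrite gt_eqF.
have r0 : 0 < Num.sqrt (v / u) by rewrite sqrtr_gt0 divr_gt0.
have S0 : 0 < Num.sqrt (2 * pi * u) by rewrite sqrtr_gt0 !mulr_gt0 ?pi_gt0.
rewrite [leRHS](_ : _ = expR (- x ^+ 2 / (2 * v)) / Num.sqrt (2 * pi * u)); last first.
  by field; rewrite !gt_eqF.
rewrite ler_wpM2r ?invr_ge0 ?sqrtr_ge0// ler_expR.
rewrite !mulNr lerN2 ler_wpM2l ?sqr_ge0// lef_pV2 ?posrE ?mulr_gt0//.
by rewrite ler_wpM2l.
Qed.

Lemma sqrt2_le : Num.sqrt (2 : R) <= 3 / 2.
Proof.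
have h : Num.sqrt 2 ^+ 2 = 2 :> R by rewrite sqr_sqrtr.
have s0 : 0 <= Num.sqrt (2 : R) by exact: sqrtr_ge0.
rewrite leNgt; apply/negP => h'; nra.
Qed.

(** With [z = x ^+ 2 / t] the claim reads
    [`|z - 1| * expR (- z / 2) <= 8 / sqrt 2 * expR (- z / 4)]: half of the
    Gaussian decay absorbs the polynomial factor, and the other half is a heat
    kernel at twice the time, whose mass is known. *)
Lemma heat_kernel2_le (t x : R) : 0 < t -> `|q2 t x| <= 8 / t * q (2 * t) x.
Proof.
move=> t0; have tn : t != 0 by rewrite gt_eqF.
rewrite /heat_kernel2 /heat_kernel.
have -> : 2 * pi * (2 * t) = 2 * (2 * pi * t) by ring.
rewrite [Num.sqrt (2 * (2 * pi * t))]sqrtrM//.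
set S := Num.sqrt (2 * pi * t).
have S0 : 0 < S by rewrite sqrtr_gt0 !mulr_gt0 ?pi_gt0.
have s20 : 0 < Num.sqrt (2 : R) by rewrite sqrtr_gt0.
set z := x ^+ 2 / t.
have z0 : 0 <= z by rewrite divr_ge0 ?sqr_ge0 ?ltW.
have -> : x ^+ 2 / t ^+ 2 - t^-1 = (z - 1) / t by rewrite /z; field.
have -> : - x ^+ 2 / (2 * t) = - (z / 4) + - (z / 4) by rewrite /z; field.
have -> : - x ^+ 2 / (2 * (2 * t)) = - (z / 4) by rewrite /z; field.
rewrite expRD; set e := expR _.
have e0 : 0 < e by exact: expR_gt0.
have ez : e * (1 + z / 4) <= 1.
  rewrite /e expRN mulrC ler_pdivrMr ?expR_gt0// mul1r.
  exact: expR_ge1Dx.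
have -> : (z - 1) / t * (e * e / S) = (z - 1) * e * (e / (t * S)).
  by field; rewrite tn gt_eqF.
have -> : 8 / t * (e / (Num.sqrt 2 * S)) = 8 / Num.sqrt 2 * (e / (t * S)).
  by field; rewrite tn !gt_eqF.
rewrite normrM [X in _ * X]gtr0_norm ?divr_gt0 ?mulr_gt0//.
apply: ler_wpM2r; first by apply/ltW; rewrite divr_gt0 ?mulr_gt0.
apply: (@le_trans _ _ 4).
  rewrite normrM (gtr0_norm e0).
  have : `|z - 1| <= 4 * (1 + z / 4) by rewrite ler_norml; apply/andP; split; lra.
  move=> h; have : `|z - 1| * e <= 4 * (1 + z / 4) * e by rewrite ler_wpM2r// ltW.
  by move/le_trans; apply; nra.
rewrite ler_pdivlMr//.
have := sqrt2_le; lra.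
Qed.

Lemma continuous_heat_kernel_time (x t : R) : 0 < t -> {for t, continuous (q^~ x)}.
Proof.
move=> t0; have [dq _] := is_derive_heat_kernel_time x t0.
exact/differentiable_continuous/derivable1_diffP.
Qed.

(** For [b <= 2 * a] the mean value theorem and the heat equation give a bound
    in [(b - a) / a], which is at most its square root; for [b > 2 * a] the
    triangle inequality is enough, since the square root exceeds 1. *)
Lemma heat_kernel_diff_le (a b x : R) : 0 < a -> a < b ->
  `|q b x - q a x| <= 6 * Num.sqrt ((b - a) / a) * (q a x + q b x + q (2 * b) x).
Proof.
move=> a0 ab; have b0 := lt_trans a0 ab.
have qa := heat_kernel_ge0 a x; have qb := heat_kernel_ge0 b x.
have q2b := heat_kernel_ge0 (2 * b) x.
set d := (b - a) / a; have d0 : 0 < d by rewrite divr_gt0// subr_gt0.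
have [d1|d1] := leP d 1; last first.
  have s1 : 1 <= Num.sqrt d by rewrite -sqrtr1 ler_sqrt ltW.
  rewrite (le_trans (ler_normB _ _))// !ger0_norm//.
  by nra.
have [||c cab ->] := @MVT R (q^~ x) (fun u => 2^-1 * q2 u x) _ _ ab.
- move=> u; rewrite in_itv/= => /andP[au _].
  by apply: is_derive_heat_kernel_time; exact: lt_trans au.
- apply: continuous_in_subspaceT => u /set_mem/=; rewrite in_itv/= => /andP[au _].
  by apply: continuous_heat_kernel_time; exact: lt_le_trans au.
move: cab; rewrite in_itv/= => /andP[ac cb]; have c0 := lt_trans a0 ac.
have ba : b <= 2 * a by move: d1; rewrite /d ler_pdivrMr// ; lra.
have h1 := heat_kernel2_le x c0.
have h2 : q (2 * c) x <= 3 / 2 * q (2 * b) x.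
  have c20 : 0 < 2 * c by rewrite mulr_gt0.
  have cb2 : 2 * c <= 2 * b by lra.
  apply: le_trans (heat_kernel_le_later x c20 cb2) _.
  rewrite ler_wpM2r//; apply: le_trans sqrt2_le.
  by rewrite ler_sqrt// ler_pdivrMr//; lra.
have h3 : 8 / c <= 8 / a by rewrite ler_wpM2l// lef_pV2 ?posrE ?ltW.
have h4 : `|q2 c x| <= 8 / a * (3 / 2 * q (2 * b) x).
  apply: le_trans h1 _; apply: ler_pM => //; last exact: heat_kernel_ge0.
  by rewrite divr_ge0// ltW.
have ds : d <= Num.sqrt d.
  have s1 : Num.sqrt d <= 1 by rewrite -sqrtr1 ler_sqrt.
  by rewrite -[leLHS](sqr_sqrtr (ltW d0)) expr2 ler_piMr ?sqrtr_ge0.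
have ba0 : 0 <= b - a by rewrite subr_ge0 ltW.
rewrite (normrM _ (b - a)) (normrM 2^-1) (ger0_norm ba0) (@ger0_norm _ (2^-1))//.
apply: (@le_trans _ _ (6 * d * q (2 * b) x)).
  rewrite (_ : 6 * d * q (2 * b) x = 2^-1 * (8 / a * (3 / 2 * q (2 * b) x)) * (b - a)).
    by apply: ler_wpM2r => //; apply: ler_wpM2l.
  by rewrite /d; field; rewrite gt_eqF.
have : 6 * d * q (2 * b) x <= 6 * Num.sqrt d * q (2 * b) x by rewrite ler_wpM2r// ler_wpM2l.
move/le_trans; apply; rewrite ler_wpM2l ?mulr_ge0 ?sqrtr_ge0//; lra.
Qed.

End heat_kernel_bounds.

(** * Integral operators with integrable kernels *)

Section convolution.
Variable R : realType.
Local Notation mu := (@lebesgue_measure R).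
Local Notation q := (@heat_kernel R).
Local Notation q2 := (@heat_kernel2 R).

(** For the even kernels used here this is the convolution of [k] and [phi]. *)
Definition kconv (k phi : R -> R) (x : R) : R := \int[mu]_y (phi y * k (y - x)).

(** The mass bound is stated for all translates of [k], which is the form in
    which [kconv] uses it. *)
Definition L1_kernel (C : R) (k : R -> R) : Prop :=
  [/\ measurable_fun setT k,
      forall x, mu.-integrable setT (EFin \o (fun y => k (y - x))) &
      forall x, \int[mu]_y `|k (y - x)| <= C].

Lemma measurable_kconv d (T : measurableType d) (k phi : T -> R -> R) (x : T -> R) :
  measurable_fun setT (fun z : T * R => k z.1 z.2) ->
  measurable_fun setT (fun z : T * R => phi z.1 z.2) ->
  measurable_fun setT x ->
  measurable_fun setT (fun s => kconv (k s) (phi s) (x s)).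
Proof.
move=> mk mphi mx.
apply: (@measurable_Rintegral_snd _ _ _ _ _ mu
  (fun z : T * R => phi z.1 z.2 * k z.1 (z.2 - x z.1))).
apply: measurable_funM => //.
apply: (measurableT_comp mk (_ : measurable_fun setT (fun z : T * R => (z.1, z.2 - x z.1)))).
apply: measurable_fun_pair => //; apply: measurable_funB => //.
exact: measurableT_comp.
Qed.

Lemma measurable_kconv_snd (k phi : R -> R) :
  measurable_fun setT k -> measurable_fun setT phi -> measurable_fun setT (kconv k phi).
Proof.
move=> mk mphi; apply: (@measurable_kconv _ _ (fun _ => k) (fun _ => phi) id) => //.
  exact: (measurableT_comp mk).
exact: (measurableT_comp mphi).
Qed.

Section bounded.
Variables (C c : R) (k phi : R -> R).
Hypotheses (kC : L1_kernel C k) (mphi : measurable_fun setT phi)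
  (phic : forall y, `|phi y| <= c).

Lemma kconv_integrable x : mu.-integrable setT (EFin \o (fun y => phi y * k (y - x))).
Proof.
have [mk ik _] := kC.
have := integrable_scaled (mu := mu) mphi phic (ik x).
by apply: eq_integrable => // y _ /=; rewrite mulrC.
Qed.

Lemma Rintegral_norm_kconv_le x : \int[mu]_y `|phi y * k (y - x)| <= c * C.
Proof.
have [mk ik kle] := kC.
have c0 : 0 <= c by apply: le_trans (phic 0).
apply: (@le_trans _ _ (c * \int[mu]_y `|k (y - x)|)); last by rewrite ler_wpM2l.
rewrite -RintegralZl//; last exact: integrable_norm (ik x).
apply: le_Rintegral => //.
- exact: integrable_norm (kconv_integrable x).
- have := integrableZl measurableT c (integrable_norm (ik x)).
  by apply: eq_integrable.
- by move=> y _; rewrite normrM ler_wpM2r.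
Qed.

Lemma kconv_le x : `|kconv k phi x| <= c * C.
Proof.
apply: le_trans (Rintegral_norm_kconv_le x).
exact: le_normr_Rintegral (kconv_integrable x).
Qed.

End bounded.

Lemma kconv_phiB C k (f g : R -> R) c c' x : L1_kernel C k ->
  measurable_fun setT f -> (forall y, `|f y| <= c) ->
  measurable_fun setT g -> (forall y, `|g y| <= c') ->
  kconv k (fun y => f y - g y) x = kconv k f x - kconv k g x.
Proof.
move=> kC mf fc mg gc; rewrite /kconv -RintegralB//; last first.
- exact: kconv_integrable kC mg gc x.
- exact: kconv_integrable kC mf fc x.
by apply: eq_Rintegral => y _; rewrite mulrBl.
Qed.

Lemma kconv_kB C C' k k' (f : R -> R) c x : L1_kernel C k -> L1_kernel C' k' ->
  measurable_fun setT f -> (forall y, `|f y| <= c) ->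
  kconv (fun y => k y - k' y) f x = kconv k f x - kconv k' f x.
Proof.
move=> kC kC' mf fc; rewrite /kconv -RintegralB//; last first.
- exact: kconv_integrable kC' mf fc x.
- exact: kconv_integrable kC mf fc x.
by apply: eq_Rintegral => y _; rewrite mulrBr.
Qed.

Lemma L1_kernel_dominated (C C' a : R) (k k' : R -> R) : 0 <= a ->
  measurable_fun setT k -> (forall x, `|k x| <= a * k' x) -> (forall x, 0 <= k' x) ->
  L1_kernel C' k' -> a * C' <= C -> L1_kernel C k.
Proof.
move=> a0 mk kk k'0 [mk' ik' k'le] aC.
have mkx (x : R) : measurable_fun setT (fun y : R => k (y - x)).
  by apply: (measurableT_comp mk); exact: measurable_funB.
have iak x : mu.-integrable setT (EFin \o (fun y => a * k' (y - x))).
  by have := integrableZl measurableT a (ik' x); apply: eq_integrable.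
have ik x : mu.-integrable setT (EFin \o (fun y => k (y - x))).
  apply: (@dominated_integrable _ _ _ mu setT _ (fun y => a * k' (y - x))
    measurableT (mkx x) _ (iak x)) => y _.
  exact: kk.
split => // x; apply: le_trans aC.
apply: (@le_trans _ _ (a * \int[mu]_y `|k' (y - x)|)); last by rewrite ler_wpM2l.
rewrite -RintegralZl//; last exact: integrable_norm (ik' x).
apply: le_Rintegral => //.
- exact: integrable_norm (ik x).
- have := integrableZl measurableT a (integrable_norm (ik' x)).
  by apply: eq_integrable.
- by move=> y _; rewrite (ger0_norm (k'0 _)).
Qed.

Lemma L1_kernelD C C' k k' : L1_kernel C k -> L1_kernel C' k' ->
  L1_kernel (C + C') (fun x => k x + k' x).
Proof.
move=> [mk ik kC] [mk' ik' kC'].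
have ikk x : mu.-integrable setT (EFin \o (fun y => k (y - x) + k' (y - x))).
  by have := integrableD measurableT (ik x) (ik' x); apply: eq_integrable.
split => //; first exact: measurable_funD.
move=> x; apply: (le_trans _ (lerD (kC x) (kC' x))).
have [nk nk'] := (integrable_norm (ik x), integrable_norm (ik' x)).
rewrite -RintegralD//; apply: le_Rintegral => //.
- exact: integrable_norm (ikk x).
- by have := integrableD measurableT nk nk'; apply: eq_integrable.
- by move=> y _; exact: ler_normD.
Qed.

Lemma L1_kernel_heat t : L1_kernel 1 (q t).
Proof.
split.
- exact: (measurable_fun_pair2 _ (@measurable_heat_kernel R)).
- by move=> x; exact: integrable_heat_kernel.
- move=> x; under eq_Rintegral do rewrite (ger0_norm (heat_kernel_ge0 _ _)).
  exact: Rintegral_heat_kernel_le1.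
Qed.

Lemma L1_kernel_heat2 t : 0 < t -> L1_kernel (8 / t) (q2 t).
Proof.
move=> t0; apply: (@L1_kernel_dominated _ 1 (8 / t) _ (q (2 * t))).
- by rewrite divr_ge0// ltW.
- exact: (measurable_fun_pair2 _ (@measurable_heat_kernel2 R)).
- by move=> x; exact: heat_kernel2_le.
- by move=> x; exact: heat_kernel_ge0.
- exact: L1_kernel_heat.
- by rewrite mulr1.
Qed.

(** The square root makes the mass an integrable function of [a] near 0, while
    it still vanishes as [b - a] tends to 0. *)
Lemma L1_kernel_heat_diff a b : 0 < a -> a < b ->
  L1_kernel (18 * Num.sqrt ((b - a) / a)) (fun x => q b x - q a x).
Proof.
move=> a0 ab.
apply: (@L1_kernel_dominated _ (1 + 1 + 1) (6 * Num.sqrt ((b - a) / a)) _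
   (fun x => q a x + q b x + q (2 * b) x)).
- by rewrite mulr_ge0// sqrtr_ge0.
- apply: measurable_funB; exact: (measurable_fun_pair2 _ (@measurable_heat_kernel R)).
- by move=> x; exact: heat_kernel_diff_le.
- by move=> x; rewrite !addr_ge0// heat_kernel_ge0.
- by do 2?[apply: L1_kernelD]; exact: L1_kernel_heat.
- lra.
Qed.

End convolution.

(** * The initial value of the heat flow *)

Section heat_initial.
Variable R : realType.
Local Notation mu := (@lebesgue_measure R).
Local Notation q := (@heat_kernel R).

Lemma heat_kernel_le_peak (t z : R) : 0 < t -> q t z <= (Num.sqrt t)^-1.
Proof.
move=> t0; rewrite /heat_kernel ler_pdivrMr ?sqrtr_gt0 ?mulr_gt0 ?pi_gt0//.
apply: (@le_trans _ _ 1).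
  by rewrite expR_le1 mulNr oppr_le0 divr_ge0 ?sqr_ge0// mulr_ge0// ltW.
have p0 : 0 < 2 * pi * t by rewrite !mulr_gt0 ?pi_gt0.
rewrite ler_pdivlMl ?sqrtr_gt0// mulr1 ler_sqrt ?(ltW p0)//.
by apply: ler_peMl; [exact/ltW|have := pi_ge2 R; lra].
Qed.

(** Outside the ball of radius [r], half of the Gaussian exponent is at least
    the constant [r ^+ 2 / (4 * t)]. *)
Lemma heat_kernel_tail (t r z : R) : 0 < t -> 0 <= r -> r <= `|z| ->
  q t z <= 2 * expR (- (r ^+ 2 / (4 * t))) * q (2 * t) z.
Proof.
move=> t0 r0 rz; rewrite /heat_kernel.
have tn : t != 0 by rewrite gt_eqF.
have -> : 2 * pi * (2 * t) = 2 * (2 * pi * t) by ring.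
rewrite [Num.sqrt (2 * (2 * pi * t))]sqrtrM//.
set S := Num.sqrt (2 * pi * t).
have S0 : 0 < S by rewrite sqrtr_gt0 !mulr_gt0 ?pi_gt0.
have s20 : 0 < Num.sqrt (2 : R) by rewrite sqrtr_gt0.
have -> : - z ^+ 2 / (2 * t) = - (z ^+ 2 / (4 * t)) + - (z ^+ 2 / (4 * t)) by field.
have -> : - z ^+ 2 / (2 * (2 * t)) = - (z ^+ 2 / (4 * t)) by field.
rewrite expRD; set e := expR (- (z ^+ 2 / _)).
have e0 : 0 < e by exact: expR_gt0.
have er : e <= expR (- (r ^+ 2 / (4 * t))).
  rewrite ler_expR lerN2 ler_wpM2r ?invr_ge0 ?mulr_ge0 ?(ltW t0)//.
  by rewrite -[z ^+ 2]real_normK ?num_real// ler_sqr ?nnegrE.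
set E := expR (- (r ^+ 2 / _)) in er *.
have -> : 2 * E * (e / (Num.sqrt 2 * S)) = (2 / Num.sqrt 2 * E) * (e / S).
  by field; rewrite !gt_eqF.
rewrite -mulrA ler_wpM2r ?divr_ge0 ?(ltW e0) ?(ltW S0)//.
have h : 1 <= 2 / Num.sqrt 2 :> R.
  by rewrite ler_pdivlMr// mul1r; have := sqrt2_le R; lra.
nra.
Qed.

(** Compare the heat kernel at time [e] with the uniform average over the ball
    of radius [K * sqrt e].  Inside the ball the kernel is at most
    [1 / sqrt e], so the error is controlled by [K] times the mean oscillation
    of [phi] on that ball, which tends to 0 at a Lebesgue point.  Outside, the
    mass of the kernel is of order [expR (- K ^+ 2 / 4)]: choose [K] large
    first, then [e] small. *)
Lemma heat_initial_lebesgue_pt (c : R) (phi : R -> R) (x : R) :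
  measurable_fun setT phi -> (forall y, `|phi y| <= c) -> lebesgue_pt phi x ->
  kconv (q e) phi x @[e --> 0^'+] --> phi x.
Proof.
move=> mphi phic /fine_cvgP[fin lim].
have c0 : 0 <= c by apply: le_trans (phic 0).
pose D y := `|phi y - phi x|.
have mD : measurable_fun setT D.
  by apply: measurableT_comp => //; exact: measurable_funB.
have Dc y : `|D y| <= 2 * c.
  by rewrite normr_id (le_trans (ler_normB _ _))// mulr2n mulrDl mul1r lerD.
have main (e r dl : R) : 0 < e -> 0 < r -> davg phi x r \is a fin_num ->
    fine (davg phi x r) <= dl ->
    `|phi x - kconv (q e) phi x| <=
     2 * r / Num.sqrt e * dl + 4 * c * expR (- (r ^+ 2 / (4 * e))).
Proof.
  move=> e0 r0 dfin ddl.
  have muball : mu (ball x r) = (r *+ 2)%:E by exact: lebesgue_measure_ball (ltW r0).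
  have iD : mu.-integrable (ball x r) (EFin \o D).
    apply: measurable_bounded_integrable.
    - exact: measurable_ball.
    - by rewrite [X in (X < _)%E]muball ltry.
    - exact: measurable_funS mD.
    - exists (2 * c); split; first exact: num_real.
      by move=> M cM y _ /=; rewrite (le_trans (Dc y))// ltW.
  have intD : \int[mu]_(y in ball x r) D y <= 2 * r * dl.
    move: ddl; rewrite /davg /iavg lebesgue_measure_ball ?(ltW r0)//.
    rewrite -(fineK (integrable_fin_num _ iD)) ?inver; last exact: measurable_ball.
    rewrite gt_eqF ?mulrn_wgt0//= => h.
    rewrite /Rintegral; move: h; rewrite ler_pdivrMl ?mulrn_wgt0//.
    by rewrite (mulr_natl r 2).
  have k1 := L1_kernel_heat e.
  have k2 := L1_kernel_heat (2 * e).
  have ix : mu.-integrable setT (EFin \o (fun y => phi x * q e (y - x))).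
    by apply: (@kconv_integrable R 1 c (q e) (fun=> phi x)).
  have iphi := kconv_integrable k1 mphi phic x.
  pose E := expR (- (r ^+ 2 / (4 * e))).
  pose B := D \_ (ball x r).
  have mball : measurable (ball x r) by exact: measurable_ball.
  have iB : mu.-integrable setT (EFin \o B).
    have := (integrable_mkcond (mu := mu) (EFin \o D) mball).1 iD.
    by apply: eq_integrable => // y _; rewrite /B /= restrict_EFin.
  have BE : \int[mu]_y B y = \int[mu]_(y in ball x r) D y.
    by rewrite [RHS]Rintegral_mkcond.
  pose G y := (Num.sqrt e)^-1 * B y + 4 * c * E * q (2 * e) (y - x).
  have i1 : mu.-integrable setT (EFin \o (fun y => (Num.sqrt e)^-1 * B y)).
    by have := integrableZl measurableT (Num.sqrt e)^-1 iB; apply: eq_integrable.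
  have iq := integrable_heat_kernel (2 * e) x.
  have i2 : mu.-integrable setT (EFin \o (fun y => 4 * c * E * q (2 * e) (y - x))).
    by have := integrableZl measurableT (4 * c * E) iq; apply: eq_integrable.
  have iG : mu.-integrable setT (EFin \o G).
    by have := integrableD measurableT i1 i2; apply: eq_integrable.
  have intG : \int[mu]_y G y <= 2 * r / Num.sqrt e * dl + 4 * c * E.
    rewrite RintegralD// !RintegralZl// Rintegral_heat_kernel ?mulr_gt0// mulr1.
    rewrite lerD2r BE (_ : 2 * r / _ * dl = (Num.sqrt e)^-1 * (2 * r * dl)).
      by rewrite ler_wpM2l// invr_ge0 sqrtr_ge0.
    by ring.
  have E0 : 0 <= E by exact: expR_ge0.
  apply: le_trans intG.
  have -> : phi x - kconv (q e) phi x = \int[mu]_y (phi x * q e (y - x) - phi y * q e (y - x)).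
    rewrite RintegralB// RintegralZl ?Rintegral_heat_kernel ?mulr1//.
    exact: integrable_heat_kernel.
  apply: normr_Rintegral_le => //.
    apply: measurable_funB; apply/measurable_EFinP.
      exact: measurable_int ix.
    exact: measurable_int iphi.
  move=> y _; rewrite -mulrBl normrM distrC -/(D y) (ger0_norm (heat_kernel_ge0 _ _)).
  have D0 : 0 <= D y by exact: normr_ge0.
  have qe0 := heat_kernel_ge0 (2 * e) (y - x).
  rewrite /G /B patchE; case: ifPn => [_|].
    apply: (@le_trans _ _ ((Num.sqrt e)^-1 * D y)).
      by rewrite mulrC ler_wpM2r// heat_kernel_le_peak.
    by rewrite lerDl !mulr_ge0.
  rewrite mulr0 add0r => /negP yx.
  have ryx : r <= `|y - x|.
    by rewrite leNgt; apply/negP => h; apply: yx; apply/mem_set; rewrite /ball /= distrC.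
  have tail := heat_kernel_tail e0 (ltW r0) ryx.
  apply: (@le_trans _ _ (2 * c * (2 * E * q (2 * e) (y - x)))).
    apply: ler_pM => //; first exact: heat_kernel_ge0.
    by have := Dc y; rewrite ger0_norm.
  by rewrite le_eqVlt; apply/orP; left; apply/eqP; ring.
apply/cvgrPdist_le => eta eta0.
(* Since [expR (- x) <= 1 / x], this [K] bounds the tail [4 c expR (- K^2 / 4)]
   by [eta / 2]; [c + 1] instead of [c] keeps [K] positive. *)
pose K := Num.sqrt (32 * (c + 1) / eta).
have KK : 0 < 32 * (c + 1) / eta by rewrite divr_gt0// mulr_gt0//; lra.
have K0 : 0 < K by rewrite sqrtr_gt0.
have tailK : 4 * c * expR (- (K ^+ 2 / 4)) <= eta / 2.
  have K2 : K ^+ 2 = 32 * (c + 1) / eta by rewrite sqr_sqrtr// ltW.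
  have h : K ^+ 2 / 4 <= expR (K ^+ 2 / 4).
    by apply: le_trans (expR_ge1Dx _); lra.
  rewrite expRN ler_pdivrMr ?expR_gt0//.
  apply: (@le_trans _ _ (eta / 2 * (K ^+ 2 / 4))); last by rewrite ler_wpM2l// divr_ge0// ltW.
  rewrite K2 [leRHS](_ : _ = 4 * (c + 1)); last by field; rewrite gt_eqF.
  lra.
have dl0 : 0 < eta / (4 * K) by rewrite divr_gt0// mulr_gt0.
have /cvgrPdist_le /(_ _ dl0) lim' := lim.
have [rho /= rho0 hrho] : exists2 rho : R, 0 < rho & forall r, 0 < r -> r < rho ->
   davg phi x r \is a fin_num /\ fine (davg phi x r) <= eta / (4 * K).
  have [rho /= rho0 h] : \forall r \near 0^'+,
     davg phi x r \is a fin_num /\ fine (davg phi x r) <= eta / (4 * K).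
    near=> r; split; first by near: r.
    have : `|0 - fine (davg phi x r)| <= eta / (4 * K) by near: r.
    by rewrite sub0r normrN; apply: le_trans; exact: ler_norm.
  exists rho => // r r0 rrho; apply: h => //=.
  by rewrite sub0r normrN gtr0_norm.
near=> e.
have e0 : 0 < e by near: e; exact: nbhs_right_gt.
have se0 : 0 < Num.sqrt e by rewrite sqrtr_gt0.
have [f1 f2] : davg phi x (K * Num.sqrt e) \is a fin_num /\
    fine (davg phi x (K * Num.sqrt e)) <= eta / (4 * K).
  apply: hrho; first by rewrite mulr_gt0.
  have : e < (rho / K) ^+ 2.
    by near: e; apply: nbhs_right_lt; rewrite exprn_gt0// divr_gt0.
  move=> h; rewrite mulrC -ltr_pdivlMr//.
  rewrite -(@ger0_norm _ (rho / K)) ?divr_ge0 ?ltW//.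
  by rewrite -sqrtr_sqr ltr_sqrt// exprn_gt0// divr_gt0.
have Kse0 : 0 < K * Num.sqrt e by rewrite mulr_gt0.
apply: le_trans (main e _ _ e0 Kse0 f1 f2) _.
have -> : 2 * (K * Num.sqrt e) / Num.sqrt e * (eta / (4 * K)) = eta / 2.
  by field; rewrite !gt_eqF.
have -> : (K * Num.sqrt e) ^+ 2 / (4 * e) = K ^+ 2 / 4.
  by rewrite exprMn (sqr_sqrtr (ltW e0)); field; rewrite gt_eqF.
lra.
Unshelve. all: by end_near. Qed.

(** Lebesgue's differentiation theorem: almost every point is a Lebesgue
    point. *)
Lemma heat_initial_ae (c : R) (phi : R -> R) :
  measurable_fun setT phi -> (forall y, `|phi y| <= c) ->
  {ae mu, forall x, kconv (q e) phi x @[e --> 0^'+] --> phi x}.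
Proof.
move=> mphi phic.
have : locally_integrable setT phi.
  split => //; first exact: openT.
  move=> K _ cK.
  have mK : measurable K by exact: compact_measurable.
  have Kfin : (mu K < +oo)%E by exact: compact_finite_measure.
  have : mu.-integrable K (EFin \o phi).
    apply: measurable_bounded_integrable => //; first exact: measurable_funS mphi.
    exists c; split; first exact: num_real.
    by move=> M cM y _ /=; rewrite (le_trans (phic y))// ltW.
  by move=> /integrableP[_].
move=> /lebesgue_differentiation; apply: filterS; first exact: (ae_filter_ringOfSetsType mu).
move=> x.
exact: heat_initial_lebesgue_pt.
Qed.

End heat_initial.

(** * Integrals and improper integrals over time intervals *)

Section interval_integrals.
Variable R : realType.
Local Notation mu := (@lebesgue_measure R).

(** The indicator function of the open interval, as an expression that is
    jointly measurable in the endpoints and the variable; integrals with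
    variable endpoints become integrals over the whole line. *)
Definition between (a c r : R) : R := ((a < r) && (r < c))%:R.

Lemma between_in a c r : a < r -> r < c -> between a c r = 1.
Proof. by move=> h1 h2; rewrite /between h1 h2. Qed.

Lemma between_ge0 a c r : 0 <= between a c r.
Proof. by rewrite /between ler0n. Qed.

Lemma between_le1 a c r : between a c r <= 1.
Proof. by rewrite /between lern1 leq_b1. Qed.

Lemma betweenM_restrict a c (f : R -> R) :
  (fun r => between a c r * f r) = f \_ `]a, c[.
Proof.
apply/funext => r; rewrite patchE mem_setE in_itv/= /between.
by case: (_ && _); rewrite ?mul1r ?mul0r.
Qed.

Lemma measurable_between d (T : measurableType d) (f g h : T -> R) :
  measurable_fun setT f -> measurable_fun setT g -> measurable_fun setT h ->
  measurable_fun setT (fun x => between (f x) (g x) (h x)).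
Proof.
move=> mf mg mh.
rewrite (_ : (fun _ => _) = (fun x => if (f x < h x) && (h x < g x) then 1 else 0)).
  apply: measurable_fun_ifT => //; apply: measurable_and; exact: measurable_fun_ltr.
by apply/funext => x; rewrite /between; case: ifP.
Qed.

Lemma interval_integralE (f : R -> R) a c :
  interval_integral f a c = \int[mu]_r (between a c r * f r).
Proof.
by rewrite /interval_integral Rintegral_mkcond -betweenM_restrict.
Qed.

Lemma interval_integrableE (f : R -> R) a c :
  interval_integrable f a c <->
  mu.-integrable setT (EFin \o (fun r => between a c r * f r)).
Proof.
rewrite /interval_integrable betweenM_restrict.
have -> : EFin \o f \_ `]a, c[ = (EFin \o f) \_ `]a, c[ by rewrite restrict_EFin.
exact: integrable_mkcond.
Qed.

Lemma betweenM_eq a c (f g : R -> R) :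
  (forall r, a < r -> r < c -> f r = g r) ->
  (fun r => between a c r * f r) = (fun r => between a c r * g r).
Proof.
move=> fg; apply/funext => r; rewrite /between.
by case: ltP => [h1|_]; case: ltP => [h2|_]; rewrite ?mul0r//= fg.
Qed.

Lemma interval_integral_eq a c (f g : R -> R) :
  (forall r, a < r -> r < c -> f r = g r) ->
  interval_integral f a c = interval_integral g a c.
Proof. by move=> fg; rewrite !interval_integralE (betweenM_eq fg). Qed.

Lemma interval_integrable_eq a c (f g : R -> R) :
  (forall r, a < r -> r < c -> f r = g r) ->
  interval_integrable f a c -> interval_integrable g a c.
Proof. by move=> fg; rewrite !interval_integrableE (betweenM_eq fg). Qed.

Lemma integrable_between a c : mu.-integrable setT (EFin \o between a c).
Proof.
have -> : between a c = (fun r => between a c r * 1) by apply/funext => r; rewrite mulr1.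
apply/interval_integrableE; rewrite /interval_integrable.
apply: measurable_bounded_integrable => //.
- by rewrite [X in (X < _)%E]lebesgue_measure_itv; case: ifP => _; rewrite ltry.
- exists 1; split; first exact: num_real.
  by move=> M h y _ /=; rewrite normr1 ltW.
Qed.

Lemma Rintegral_between a c : a <= c -> \int[mu]_r between a c r = c - a.
Proof.
move=> ac; under eq_Rintegral do rewrite -[between _ _ _]mulr1.
rewrite -(interval_integralE (cst 1)) /interval_integral.
have h : mu `]a, c[%classic = (if a < c then (c - a)%:E else 0%E).
  by rewrite lebesgue_measure_itv/= lte_fin EFinB.
rewrite Rintegral_cst// mul1r [X in fine X]h.
by case: ltP => //= ca; rewrite (le_anti (_ : c <= a <= c)) ?subrr// ca ac.
Qed.

Lemma interval_integrable_bounded a c (f : R -> R) (k : R) :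
  measurable_fun setT f -> (forall r, a < r -> r < c -> `|f r| <= k) ->
  interval_integrable f a c.
Proof.
move=> mf fk; apply/interval_integrableE.
apply: (@dominated_integrable _ _ _ mu setT _ (fun r => k * between a c r)) => //.
- by apply: measurable_funM => //; exact: measurable_between.
- move=> r _; rewrite normrM (ger0_norm (between_ge0 _ _ _)) mulrC /between.
  by case: ltP => [h1|_]; case: ltP => [h2|_]; rewrite ?mulr0//= !mulr1 fk.
- by have := integrableZl measurableT k (integrable_between a c); apply: eq_integrable.
Qed.

(** The two requirements of [improper_integrable], with the value of the limit
    made explicit. *)
Definition improper_cvg (f : R -> R) (a c l : R) : Prop :=
  (forall e : R, 0 < e -> interval_integrable f (a + e) c) /\
  interval_integral f (a + e) c @[e --> 0^'+] --> l.

Lemma improper_cvg_integrable f a c l : improper_cvg f a c l -> improper_integrable f a c.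
Proof. by move=> [h1 h2]; split => //; apply/cvg_ex; exists l. Qed.

Lemma improper_cvg_integral f a c l : improper_cvg f a c l -> improper_integral f a c = l.
Proof. by move=> [_ h]; apply: cvg_lim => //; exact: Rhausdorff. Qed.

Lemma improper_cvg_eq (f g : R -> R) a c l :
  (forall r, a < r -> r < c -> f r = g r) ->
  improper_cvg f a c l -> improper_cvg g a c l.
Proof.
move=> fg [fi fl].
have fge e : 0 < e -> forall r, a + e < r -> r < c -> f r = g r.
  by move=> e0 r aer; apply: fg; apply: lt_trans aer; rewrite ltrDl.
split=> [e e0|]; first exact: (interval_integrable_eq (fge e e0)) (fi e e0).
apply: cvg_trans fl; apply: near_eq_cvg; near=> e.
apply: interval_integral_eq; apply: fge; near: e; exact: nbhs_right_gt.
Unshelve. all: by end_near. Qed.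

Lemma interval_integrableD a c (f g : R -> R) :
  interval_integrable f a c -> interval_integrable g a c ->
  interval_integrable (fun r => f r + g r) a c.
Proof.
rewrite /interval_integrable => fi gi.
by have := integrableD (mu := mu) (measurable_itv _) fi gi; apply: eq_integrable.
Qed.

Lemma improper_cvgD (f g : R -> R) a c l l' :
  improper_cvg f a c l -> improper_cvg g a c l' ->
  improper_cvg (fun r => f r + g r) a c (l + l').
Proof.
move=> [fi fl] [gi gl]; split=> [e e0|].
  by apply: interval_integrableD; [exact: fi|exact: gi].
apply: cvg_trans (cvgD fl gl); apply: near_eq_cvg; near=> e.
have e0 : 0 < e by near: e; exact: nbhs_right_gt.
by rewrite /interval_integral RintegralD//; [exact: fi|exact: gi].
Unshelve. all: by end_near. Qed.

End interval_integrals.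

Section absolutely_convergent.
Variable R : realType.
Local Notation mu := (@lebesgue_measure R).

(** Dominated convergence along the continuous parameter [e], by restriction to
    sequences. *)
Lemma cvg_right_dominated d (T : measurableType d) (m : {measure set T -> \bar R})
    (F : R -> T -> R) (L g : T -> R) :
  (forall e, measurable_fun setT (F e)) -> measurable_fun setT L ->
  {ae m, forall y, F e y @[e --> 0^'+] --> L y} ->
  m.-integrable setT (EFin \o g) ->
  (forall e y, 0 < e -> `|F e y| <= g y) ->
  \int[m]_y F e y @[e --> 0^'+] --> \int[m]_y L y.
Proof.
move=> mF mL FL gi Fg; apply/cvg_at_rightP => u [u0 ucvg].
have [] := @dominated_convergence _ _ _ m setT measurableT
  (fun n => EFin \o F (u n)) (EFin \o L) (EFin \o g).
- by move=> n; exact/measurable_EFinP.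
- exact/measurable_EFinP.
- move: FL; apply: filterS => y /= Fy _; apply/fine_cvgP; split.
    by near=> n.
  exact: ((cvg_at_rightP _ _ _).1 Fy u (conj u0 ucvg)).
- exact: gi.
- by apply: aeW => y n _; rewrite /= lee_fin Fg.
move=> iL _ h; apply: fine_cvg; rewrite fineK//; exact: integrable_fin_num.
Unshelve. all: by end_near. Qed.

(** An absolutely convergent integral is also an improper one: the truncations
    are dominated by the integrand. *)
Lemma improper_cvg_abs (f : R -> R) a c : interval_integrable f a c ->
  improper_cvg f a c (interval_integral f a c).
Proof.
move=> fi; split=> [e e0|].
  apply: integrableS fi => //; apply: subset_itvr; rewrite bnd_simp.
  by rewrite lerDl ltW.
have fi' := (interval_integrableE _ _ _).1 fi.
have mf : measurable_fun setT (fun r => between a c r * f r).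
  by apply/measurable_EFinP; exact: measurable_int fi'.
rewrite interval_integralE.
have nfi := integrable_norm fi'.
apply: cvg_trans; last first.
  apply: (@cvg_right_dominated _ _ mu
    (fun e r => between (a + e) c r * (between a c r * f r)) _ _ _ mf _ nfi).
  - by move=> e; apply: measurable_funM => //; exact: measurable_between.
  - apply: aeW => r /=; apply: cvg_near_cst; rewrite /between.
    case: (ltP a r) => [ar|ra] /=; last by near=> e; rewrite !mul0r mulr0.
    near=> e; suff -> : a + e < r.
      by case: (r < c); rewrite /= ?mulr1n ?mulr0n ?mul1r ?mul0r.
    by rewrite -ltrBrDl; near: e; apply: nbhs_right_lt; rewrite subr_gt0.
  - move=> e r e0 /=; rewrite normrM (ger0_norm (between_ge0 _ _ _)).
    by rewrite ler_piMl// between_le1.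
apply: near_eq_cvg; near=> e.
have e0 : 0 < e by near: e; exact: nbhs_right_gt.
rewrite interval_integralE; apply: eq_Rintegral => r _.
rewrite mulrA; congr (_ * _); rewrite /between.
case: (ltP a r) => [ar|ra] /=.
  by case: (a + e < r); case: (r < c); rewrite /= ?mulr1n ?mulr0n ?mulr1 ?mulr0.
by rewrite mulr0; case: ltP => // h; move: (lt_le_trans h ra); rewrite gtrDl ltNge (ltW e0).
Unshelve. all: by end_near. Qed.

End absolutely_convergent.

(** * Explicit time integrals *)

Section time_integrals.
Variable R : realType.
Local Notation mu := (@lebesgue_measure R).
Local Notation q := (@heat_kernel R).
Local Notation q2 := (@heat_kernel2 R).

Lemma interval_integral_FTC (f F : R -> R) (a c : R) : a < c ->
  (forall r, a <= r <= c -> is_derive r (1 : R) F (f r)) ->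
  (forall r, a <= r <= c -> {for r, continuous f}) ->
  interval_integrable f a c /\ interval_integral f a c = F c - F a.
Proof.
move=> ac dF cf.
have cF r : a <= r <= c -> {for r, continuous F}.
  by move=> /dF[dFr _]; exact/differentiable_continuous/derivable1_diffP.
have cw : {within `[a, c], continuous f}.
  by apply: continuous_in_subspaceT => r /set_mem/=; rewrite in_itv/=; exact: cf.
have ii : mu.-integrable `[a, c] (EFin \o f).
  by apply: continuous_compact_integrable => //; exact: segment_compact.
have io : mu.-integrable `]a, c[ (EFin \o f).
  by apply: integrableS ii => //; exact: subset_itv_oo_cc.
have ioc : mu.-integrable `]a, c] (EFin \o f).
  by apply: integrableS ii => //; exact: subset_itv_oc_cc.
split=> //; rewrite /interval_integral.
rewrite Rintegral_itv_bndo_bndc// Rintegral_itv_obnd_cbnd//.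
rewrite /Rintegral (@continuous_FTC2 _ f F _ _ ac cw)//; last first.
  move=> r; rewrite in_itv/= => /andP[ar rc]; rewrite derive1E.
  by apply: derive_val; apply: dF; rewrite !ltW.
split.
- by move=> r; rewrite in_itv/= => /andP[ar rc]; apply: ex_derive; apply: dF; rewrite !ltW.
- by apply: cvg_at_right_filter; apply: cF; rewrite lexx ltW.
- by apply: cvg_at_left_filter; apply: cF; rewrite lexx ltW.
Qed.

(** Away from [s] the integral is given by the primitive
    [2 * sqrt (r - s)]; monotone convergence passes to the whole interval. *)
Lemma inv_sqrt_integral (s t : R) : s < t ->
  interval_integrable (fun r => (Num.sqrt (r - s))^-1) s t /\
  interval_integral (fun r => (Num.sqrt (r - s))^-1) s t <= 2 * Num.sqrt (t - s).
Proof.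
move=> st; pose f r := (Num.sqrt (r - s))^-1.
have f0 r : 0 <= f r by rewrite invr_ge0 sqrtr_ge0.
have mf : measurable_fun setT f.
  apply: (measurableT_comp (@measurable_invr R)).
  by apply: (measurableT_comp (@measurable_sqrt R)); exact: measurable_funB.
have st0 : 0 < t - s by rewrite subr_gt0.
(* The shift by 2 keeps [s + e n] strictly below [t] for every [n]. *)
pose e n : R := (t - s) / n.+2%:R.
have e0 n : 0 < e n by rewrite divr_gt0.
have et n : s + e n < t.
  by rewrite -ltrBrDl ltr_pdivrMr// ltr_pMr// ltr1n.
pose g n r : \bar R := (between (s + e n) t r * f r)%:E.
have ig n : (\int[mu]_r g n r <= (2 * Num.sqrt (t - s))%:E)%E.
  have [] := @interval_integral_FTC f (fun r => 2 * Num.sqrt (r - s)) _ _ (et n).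
  - move=> r /andP[er _].
    have rs : 0 < r - s by rewrite subr_gt0 (lt_le_trans _ er)// ltrDl.
    have d1 : is_derive r (1 : R) (fun r : R => r - s) 1.
      by apply: is_derive_eq; rewrite subr0.
    have ds := @is_derive1_comp _ Num.sqrt (fun r : R => r - s) r _ _ (is_derive1_sqrt rs) d1.
    apply: (is_derive_eq (is_deriveZ 2 ds)); rewrite /GRing.scale/= /f mulr1.
    by field; rewrite gt_eqF// sqrtr_gt0.
  - move=> r /andP[er _].
    have rs : 0 < r - s by rewrite subr_gt0 (lt_le_trans _ er)// ltrDl.
    apply: (@continuousV _ _ (fun r => Num.sqrt (r - s))).
      by rewrite gt_eqF// sqrtr_gt0.
    apply: (@continuous_comp _ _ _ (fun r => r - s) Num.sqrt).
      by apply: continuousB; [exact: cvg_id|exact: cvg_cst].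
    exact: sqrt_continuous.
  move=> fi; rewrite interval_integralE => fE.
  have fi' := (interval_integrableE _ _ _).1 fi.
  rewrite -(fineK (integrable_fin_num measurableT fi')) lee_fin [leLHS]fE.
  by rewrite lerBlDr lerDl mulr_ge0// sqrtr_ge0.
have mg n : measurable_fun setT (g n).
  by apply/measurable_EFinP; apply: measurable_funM => //; exact: measurable_between.
have g0 n r : setT r -> (0 <= g n r)%E.
  by move=> _; rewrite lee_fin mulr_ge0// between_ge0.
have gnd r : setT r -> {homo g^~ r : n m / (n <= m)%N >-> (n <= m)%E}.
  move=> _ n m nm; rewrite lee_fin ler_wpM2r// /between.
  have emn : e m <= e n.
    by rewrite /e ler_wpM2l ?(ltW st0)// lef_pV2 ?posrE ?ltr0n// ler_nat !ltnS.
  have [h|] := ltP (s + e n) r; last by rewrite ler0n.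
  by rewrite (le_lt_trans _ h)// lerD2l.
have lim r : limn (g^~ r) = (between s t r * f r)%:E.
  apply/cvg_lim => //; apply/fine_cvgP; split; first by near=> n.
  apply: cvg_near_cst; rewrite /between /=.
  case: (ltP s r) => [sr|rs] /=; last first.
    near=> n; rewrite /g /between /= (_ : (s + e n < r) = false)//.
    by apply/negbTE; rewrite -leNgt (le_trans rs)// lerDl ltW.
  near=> n; rewrite /g /between /=; suff -> : s + e n < r by [].
  rewrite -ltrBrDl /e ltr_pdivrMr// mulrC -ltr_pdivrMr ?subr_gt0//.
  apply: (@lt_trans _ _ n%:R); last by rewrite ltr_nat.
  by near: n; exact: nbhs_infty_gtr.
have bound : (\int[mu]_r (between s t r * f r)%:E <= (2 * Num.sqrt (t - s))%:E)%E.
  under eq_integral do rewrite -lim.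
  rewrite (monotone_convergence mu measurableT mg g0 gnd).
  apply: lime_le; last by near=> n; exact: ig.
  apply: ereal_nondecreasing_is_cvgn => n m nm; apply: ge0_le_integral => //.
  - by move=> r _; exact: (g0 n r I).
  - exact: mg.
  - exact: mg.
  - by move=> r _; exact: (gnd r I n m nm).
have mb : measurable_fun setT (fun r => between s t r * f r).
  by apply: measurable_funM => //; exact: measurable_between.
have fi : mu.-integrable setT (EFin \o (fun r => between s t r * f r)).
  apply/integrableP; split; first exact/measurable_EFinP.
  under eq_integral do rewrite gee0_abs ?lee_fin ?mulr_ge0 ?between_ge0//.
  by apply: le_lt_trans bound _; rewrite ltry.
split; first exact/interval_integrableE.
rewrite interval_integralE -lee_fin /Rintegral fineK//.
exact: (integrable_fin_num measurableT fi).
Unshelve. all: by end_near. Qed.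

End time_integrals.

(** * Integrating out the last space variable *)

Section backward_step.
Context d (T : measurableType d) (R : realType).
Variable m : {sigma_finite_measure set T -> \bar R}.
Local Notation mu := (@lebesgue_measure R).
Local Notation q := (@heat_kernel R).
Local Notation q2 := (@heat_kernel2 R).
Variables (G : T -> R) (p : T -> R).
Hypotheses (iG : m.-integrable setT (EFin \o G)) (mp : measurable_fun setT p).

Let mG : measurable_fun setT G.
Proof. by apply/measurable_EFinP; exact: measurable_int iG. Qed.

Section step.
Variables (C c : R) (k phi : R -> R).
Hypotheses (kC : L1_kernel C k) (mphi : measurable_fun setT phi)
  (phic : forall y, `|phi y| <= c).

(** One variable is added to the weight [G]: [p] reads the last space variable
    of [y : T], and the new one is coupled to it by the kernel [k]. *)
Lemma backward_step_integrable : (m \x mu)%E.-integrable setT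
  (EFin \o (fun z : T * R => G z.1 * (phi z.2 * k (z.2 - p z.1)))).
Proof.
have [mk _ _] := kC.
have ik y := kconv_integrable kC mphi phic (p y).
apply: (@integrable_prod_fst _ _ _ _ _ m mu _ (fun y => (c * C) * `|G y|)).
- apply: measurable_funM; first exact: measurableT_comp.
  apply: measurable_funM; first exact: measurableT_comp.
  apply: (measurableT_comp mk); apply: measurable_funB => //.
  exact: measurableT_comp.
- move=> y /=; have := integrableZl measurableT (G y) (ik y).
  by apply: eq_integrable.
- move=> y /=; under eq_Rintegral do rewrite normrM.
  rewrite RintegralZl//; last exact: integrable_norm (ik y).
  rewrite mulrC ler_wpM2r//; exact: Rintegral_norm_kconv_le kC mphi phic (p y).
- have := integrableZl measurableT (c * C) (integrable_norm iG).
  by apply: eq_integrable.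
Qed.

(** Integrating out the added variable applies [kconv k] to [phi]. *)
Lemma backward_step_integral :
  \int[(m \x mu)%E]_z (G z.1 * (phi z.2 * k (z.2 - p z.1))) =
  \int[m]_y (G y * kconv k phi (p y)).
Proof.
rewrite (Rintegral_prod_fst backward_step_integrable); apply: eq_Rintegral => y _ /=.
by rewrite RintegralZl//; exact: kconv_integrable kC mphi phic (p y).
Qed.

End step.

Lemma integrable_weighted_comp (psi : R -> R) c : measurable_fun setT psi ->
  (forall y, `|psi y| <= c) ->
  m.-integrable setT (EFin \o (fun y => G y * psi (p y))).
Proof.
move=> mpsi psic; apply: (integrable_scaled (c := c)) => //.
exact: measurableT_comp.
Qed.

Lemma normr_Rintegral_weighted_comp_le (psi : R -> R) c : measurable_fun setT psi ->
  (forall y, `|psi y| <= c) ->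
  `|\int[m]_y (G y * psi (p y))| <= c * \int[m]_y `|G y|.
Proof.
move=> mpsi psic; have nG := integrable_norm iG.
rewrite -RintegralZl//; apply: normr_Rintegral_le => //.
- by apply: measurable_funM => //; exact: measurableT_comp.
- by move=> y _; rewrite normrM mulrC ler_wpM2r.
- by have := integrableZl measurableT c nG; apply: eq_integrable.
Qed.

Lemma time_space_measurable (F : R -> R -> R) :
  measurable_fun setT (fun z : R * R => F z.1 z.2) ->
  measurable_fun setT (fun r => \int[m]_y (G y * F r (p y))).
Proof.
move=> mF; apply: (@measurable_Rintegral_snd _ _ _ _ _ m
  (fun z : R * T => G z.2 * F z.1 (p z.2))).
apply: measurable_funM; first exact: measurableT_comp.
apply: (measurableT_comp mF (_ : measurable_fun setT (fun z : R * T => (z.1, p z.2)))).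
by apply: measurable_fun_pair => //; exact: measurableT_comp.
Qed.

Lemma time_space_fubini (F : R -> R -> R) (a t c : R) : 0 <= c ->
  measurable_fun setT (fun z : R * R => F z.1 z.2) ->
  (forall r y, a < r -> r < t -> `|F r y| <= c) ->
  interval_integral (fun r => \int[m]_y (G y * F r (p y))) a t =
  \int[m]_y (G y * interval_integral (F ^~ (p y)) a t).
Proof.
move=> c0 mF Fc.
have mFr r : measurable_fun setT (F r) by exact: (measurable_fun_pair2 _ mF).
have mFy y : measurable_fun setT (F^~ y) by exact: (measurable_fun_pair1 _ mF).
have bF r y : `|between a t r * F r y| <= c.
  rewrite normrM (ger0_norm (between_ge0 _ _ _)) /between.
  case: ltP => [ar|_]; last by rewrite mul0r.
  by case: ltP => [rt|_]; rewrite ?mul0r// mul1r; exact: Fc.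
have ibF r : m.-integrable setT (EFin \o (fun y => between a t r * (G y * F r (p y)))).
  have h : measurable_fun setT (fun y => between a t r * F r y) by exact: measurable_funM.
  by have := integrable_weighted_comp h (bF r); apply: eq_integrable => // y _ /=; rewrite mulrCA.
have mf : measurable_fun setT (fun z : R * T => between a t z.1 * (G z.2 * F z.1 (p z.2))).
  apply: measurable_funM; first exact: measurable_between.
  apply: measurable_funM; first exact: measurableT_comp.
  apply: (measurableT_comp mF (_ : measurable_fun setT (fun z : R * T => (z.1, p z.2)))).
  by apply: measurable_fun_pair => //; exact: measurableT_comp.
have ifub : (mu \x m)%E.-integrable setT
    (EFin \o (fun z : R * T => between a t z.1 * (G z.2 * F z.1 (p z.2)))).
  apply: (@integrable_prod_fst _ _ _ _ _ mu m _
     (fun r => c * (\int[m]_y `|G y|) * between a t r)) => //.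
  - move=> r /=.
    have nG := integrable_norm iG.
    rewrite -mulrA [_ * between _ _ _]mulrC mulrA -RintegralZl//.
    apply: le_Rintegral => //.
    + exact: integrable_norm (ibF r).
    + by have := integrableZl measurableT (c * between a t r) nG; apply: eq_integrable.
    + move=> y _; rewrite !normrM (ger0_norm (between_ge0 _ _ _)) /between.
      case: ltP => [ar|_]; last by rewrite mul0r !mulr0 mul0r.
      case: ltP => [rt|_]; last by rewrite mul0r !mulr0 mul0r.
      by rewrite mul1r mulr1 mulrC ler_wpM2r//; exact: Fc.
  - have := integrableZl measurableT (c * (\int[m]_y `|G y|)) (integrable_between a t).
    by apply: eq_integrable.
rewrite interval_integralE.
transitivity (\int[mu]_r \int[m]_y (between a t r * (G y * F r (p y)))).
  apply: eq_Rintegral => r _; rewrite /between.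
  case: ltP => [ar|_]; last first.
    rewrite mul0r; under [RHS]eq_Rintegral do rewrite mul0r.
    by rewrite Rintegral_cst// mul0r.
  case: ltP => [rt|_]; last first.
    rewrite mul0r; under [RHS]eq_Rintegral do rewrite mul0r.
    by rewrite Rintegral_cst// mul0r.
  by rewrite mul1r; apply: eq_Rintegral => y _; rewrite mul1r.
rewrite (Rintegral_swap ifub) /=; apply: eq_Rintegral => y _.
have iy : mu.-integrable setT (EFin \o (fun r => between a t r * F r (p y))).
  by apply/interval_integrableE; apply: interval_integrable_bounded => // r ar rt; exact: Fc.
rewrite interval_integralE -RintegralZl//.
by apply: eq_Rintegral => r _; rewrite mulrCA.
Qed.

End backward_step.

Section improper_heat2.
Variable R : realType.
Local Notation mu := (@lebesgue_measure R).
Local Notation q := (@heat_kernel R).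
Local Notation q2 := (@heat_kernel2 R).

Lemma heat_kernel2_time_integral (s a t z : R) : s < a -> a < t ->
  interval_integrable (fun r => q2 (r - s) z) a t /\
  interval_integral (fun r => q2 (r - s) z) a t = 2 * (q (t - s) z - q (a - s) z).
Proof.
move=> sa at_.
have ps r : a <= r -> 0 < r - s by move=> ar; rewrite subr_gt0 (lt_le_trans sa).
have := @interval_integral_FTC R (fun r => q2 (r - s) z) (fun r => 2 * q (r - s) z) a t at_.
case.
- move=> r /andP[ar _].
  have d1 : is_derive r (1 : R) (fun r : R => r - s) 1.
    by apply: is_derive_eq; rewrite subr0.
  have ds := @is_derive1_comp _ (q^~ z) (fun r : R => r - s) r _ _
    (is_derive_heat_kernel_time z (ps r ar)) d1.
  apply: (is_derive_eq (is_deriveZ 2 ds)); rewrite /GRing.scale/= mulr1.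
  by rewrite mulrA divff ?mul1r.
- move=> r /andP[ar _].
  have csub : {for r, continuous (fun r => r - s)}.
    by apply: continuousB; [exact: cvg_id|exact: cvg_cst].
  have rs0 : r - s != 0 by rewrite gt_eqF// ps.
  have c1 : {for r, continuous (fun r => (r - s)^-1)}.
    exact: (@continuousV _ _ (fun r => r - s)).
  have c2 : {for r, continuous (fun r => ((r - s) ^+ 2)^-1)}.
    apply: (@continuousV _ _ (fun r => (r - s) ^+ 2)); first by rewrite expf_neq0.
    apply: (@continuous_comp _ _ _ (fun r => r - s) (fun x => x ^+ 2)) => //.
    exact: exprn_continuous.
  apply: (@continuousM _ _
    (fun r => z ^+ 2 / (r - s) ^+ 2 - (r - s)^-1) (fun r => q (r - s) z)).
    apply: continuousB => //; apply: continuousM => //; exact: cvg_cst.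
  apply: (@continuous_comp _ _ _ (fun r => r - s) (q^~ z)) => //.
  exact: continuous_heat_kernel_time (ps r ar).
by move=> h ->; split => //; rewrite mulrBr.
Qed.

(** Exchange the integrals in [r] and [y] and use the heat equation for fixed
    [y].  The exchange is legitimate because [r - s] stays above [a - s > 0],
    where the mass of [q2] is at most [8 / (a - s)]. *)
Lemma kconv_heat2_time_integral (phi : R -> R) (c s a t x : R) :
  measurable_fun setT phi -> (forall y, `|phi y| <= c) -> s < a -> a < t ->
  interval_integral (fun r => kconv (q2 (r - s)) phi x) a t =
  2 * (kconv (q (t - s)) phi x - kconv (q (a - s)) phi x).
Proof.
move=> mphi phic sa at_.
have c0 : 0 <= c by apply: le_trans (phic 0).
have as0 : 0 < a - s by rewrite subr_gt0.
have k2 r : a < r -> L1_kernel (8 / (r - s)) (q2 (r - s)).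
  by move=> ar; apply: L1_kernel_heat2; rewrite subr_gt0 (lt_trans sa).
pose f (z : R * R) := between a t z.1 * (phi z.2 * q2 (z.1 - s) (z.2 - x)).
have mf : measurable_fun setT f.
  apply: measurable_funM; first exact: measurable_between.
  apply: measurable_funM; first exact: measurableT_comp.
  apply: (measurableT_comp (@measurable_heat_kernel2 R)
    (_ : measurable_fun setT (fun z : R * R => (z.1 - s, z.2 - x)))).
  by apply: measurable_fun_pair; exact: measurable_funB.
have fi r : mu.-integrable setT (EFin \o (fun y => f (r, y))).
  rewrite /f /between /=.
  have [ar|_] := ltP a r; last first.
    apply: eq_integrable (integrable0 mu setT) => // y _ /=; by rewrite mul0r.
  have ik := kconv_integrable (k2 r ar) mphi phic x.
  have := integrableZl measurableT ((true && (r < t))%:R : R) ik.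
  by apply: eq_integrable.
have ifub : (mu \x mu)%E.-integrable setT (EFin \o f).
  apply: (@integrable_prod_fst _ _ _ _ _ mu mu _
     (fun r => c * (8 / (a - s)) * between a t r)) => //.
  - move=> r; rewrite /f /=.
    have [ar|ra] := ltP a r; last first.
      have b0 : between a t r = 0 by rewrite /between ltNge ra.
      under eq_Rintegral do rewrite b0 mul0r normr0.
      by rewrite b0 mulr0 Rintegral_cst// mul0r.
    under eq_Rintegral do rewrite normrM (ger0_norm (between_ge0 _ _ _)).
    rewrite RintegralZl//; last exact: integrable_norm (kconv_integrable (k2 r ar) mphi phic x).
    rewrite mulrC ler_wpM2r ?between_ge0//.
    apply: le_trans (Rintegral_norm_kconv_le (k2 r ar) mphi phic x) _.
    rewrite ler_wpM2l// ler_wpM2l// lef_pV2 ?posrE ?subr_gt0//; last exact: lt_trans ar.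
    by rewrite lerD2r ltW.
  - have := integrableZl measurableT (c * (8 / (a - s))) (integrable_between a t).
    by apply: eq_integrable.
rewrite interval_integralE.
transitivity (\int[mu]_r \int[mu]_y f (r, y)).
  apply: eq_Rintegral => r _; rewrite /f /=.
  have [ar|ra] := ltP a r; last first.
    have b0 : between a t r = 0 by rewrite /between ltNge ra.
    rewrite b0 mul0r; under [RHS]eq_Rintegral do rewrite mul0r.
    by rewrite Rintegral_cst// mul0r.
  by rewrite RintegralZl//; exact: (kconv_integrable (k2 r ar) mphi phic x).
rewrite (Rintegral_swap ifub).
have i1 := kconv_integrable (L1_kernel_heat (t - s)) mphi phic x.
have i2 := kconv_integrable (L1_kernel_heat (a - s)) mphi phic x.
rewrite /kconv -RintegralB// -RintegralZl//; last first.
  by have := integrableB measurableT i1 i2; apply: eq_integrable.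
apply: eq_Rintegral => y _; rewrite /f /=.
have [ti tE] := heat_kernel2_time_integral (y - x) sa at_.
transitivity (\int[mu]_r (phi y * (between a t r * q2 (r - s) (y - x)))).
  by apply: eq_Rintegral => r _; rewrite mulrCA.
rewrite RintegralZl//; last exact: ((interval_integrableE _ _ _).1 ti).
by rewrite -interval_integralE tE; ring.
Qed.

Context d (T : measurableType d).
Variable m : {sigma_finite_measure set T -> \bar R}.
Variables (G : T -> R) (p : T -> R).
Hypotheses (iG : m.-integrable setT (EFin \o G)) (mp : measurable_fun setT p).
Hypothesis null_p : forall N, measurable N -> mu N = 0%E -> m (p @^-1` N) = 0%E.

Let mG : measurable_fun setT G.
Proof. by apply/measurable_EFinP; exact: measurable_int iG. Qed.

(** The cancellation at the singular time [r = s].  Truncated at [s + e], the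
    time integral is the weighted integral of
    [2 * (kconv (q (t - s)) phi - kconv (q e) phi)], and the second term
    converges almost everywhere to [phi] by [heat_initial_ae].  The hypothesis
    [null_p] transports the exceptional null set from the line to [T]. *)
Lemma improper_cvg_heat2 (phi : R -> R) (c s t : R) :
  measurable_fun setT phi -> (forall y, `|phi y| <= c) -> s < t ->
  improper_cvg (fun r => \int[m]_y (G y * kconv (q2 (r - s)) phi (p y))) s t
    (\int[m]_y (G y * (2 * (kconv (q (t - s)) phi (p y) - phi (p y))))).
Proof.
move=> mphi phic st.
have c0 : 0 <= c by apply: le_trans (phic 0).
pose F r := kconv (q2 (r - s)) phi.
have mF : measurable_fun setT (fun z : R * R => F z.1 z.2).
  rewrite /F; apply: (@measurable_kconv R _ (R * R)%type
    (fun z => q2 (z.1 - s)) (fun _ => phi) (fun z => z.2)) => //=.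
    apply: (measurableT_comp (@measurable_heat_kernel2 R)
      (_ : measurable_fun setT (fun z : (R * R) * R => (z.1.1 - s, z.2)))).
    apply: measurable_fun_pair => //; apply: measurable_funB => //.
    exact: measurableT_comp.
  - exact: measurableT_comp.
  - exact: measurable_snd.
have bF e r y : 0 < e -> s + e < r -> `|kconv (q2 (r - s)) phi y| <= c * (8 / e).
  move=> e0 er; have rs : 0 < r - s by rewrite subr_gt0 (lt_trans _ er)// ltrDl.
  apply: le_trans (kconv_le (L1_kernel_heat2 rs) mphi phic y) _.
  rewrite ler_wpM2l// ler_wpM2l// lef_pV2 ?posrE//.
  by rewrite lerBrDl ltW.
have ce e : 0 < e -> 0 <= c * (8 / e) by move=> e0; rewrite mulr_ge0// divr_ge0// ltW.
rewrite /improper_cvg; split=> [e e0|].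
  apply: (@interval_integrable_bounded _ _ _ _ (c * (8 / e) * \int[m]_y `|G y|)).
    exact: (time_space_measurable iG mp (F := F) mF).
  move=> r er rt; apply: (normr_Rintegral_weighted_comp_le iG mp).
    exact: (measurable_fun_pair2 _ mF).
  by move=> y; exact: bF.
have mq t' : measurable_fun setT (fun y => kconv (q t') phi y).
  apply: measurable_kconv_snd => //.
  exact: (measurable_fun_pair2 _ (@measurable_heat_kernel R)).
have qc t' y : `|kconv (q t') phi y| <= c.
  by rewrite -[c]mulr1; exact: kconv_le (L1_kernel_heat t') mphi phic y.
apply: cvg_trans; last first.
  apply: (@cvg_right_dominated _ _ _ m
    (fun e y => G y * (2 * (kconv (q (t - s)) phi (p y) - kconv (q e) phi (p y))))
    _ (fun y => (2 * (c + c)) * `|G y|)).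
  - move=> e; apply: measurable_funM => //; apply: measurable_funM => //.
    by apply: measurable_funB; exact: measurableT_comp.
  - apply: measurable_funM => //; apply: measurable_funM => //.
    by apply: measurable_funB; exact: measurableT_comp.
  - have [N [mN N0 hN]] := heat_initial_ae mphi phic.
    exists (p @^-1` N); split.
    + by rewrite -[X in measurable X]setTI; exact: mp.
    + exact: null_p.
    + move=> y /= hy; apply: hN => /= hc; apply: hy.
      apply: cvgM; first exact: cvg_cst.
      apply: cvgM; first exact: cvg_cst.
      by apply: cvgB => //; exact: cvg_cst.
  - have := integrableZl measurableT (2 * (c + c)) (integrable_norm iG).
    by apply: eq_integrable.
  - move=> e y e0; rewrite normrM mulrC ler_wpM2r// normrM ger0_norm//.
    by rewrite ler_wpM2l// (le_trans (ler_normB _ _))// lerD.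
apply: near_eq_cvg; near=> e.
have e0 : 0 < e by near: e; exact: nbhs_right_gt.
have et : s + e < t.
  by rewrite -ltrBrDl; near: e; apply: nbhs_right_lt; rewrite subr_gt0.
rewrite (time_space_fubini iG mp (ce e e0) (F := F) mF); last by move=> r y er _; exact: bF.
apply: eq_Rintegral => y _; congr (_ * _).
rewrite (kconv_heat2_time_integral _ mphi phic _ et) ?ltrDl//.
by rewrite [s + e - s]addrAC subrr add0r.
Unshelve. all: by end_near. Qed.

End improper_heat2.

(** * The source left by the innermost integrals and its propagation *)

Section profile.
Variables (R : realType) (b : R -> R) (M t : R).
Hypotheses (mb : measurable_fun setT b) (bM : forall y, `|b y| <= M).
Local Notation mu := (@lebesgue_measure R).
Local Notation q := (@heat_kernel R).
Local Notation q2 := (@heat_kernel2 R).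

Let M0 : 0 <= M. Proof. by apply: le_trans (bM 0). Qed.

(** What the integrals in [y4] and in [s4 > r] leave as a function of
    [y = y3] at time [r = s3], including the factor [b y3]. *)
Definition inner_source (r y : R) : R := 2 * (b y * (kconv (q (t - r)) b y - b y)).

(** What all integrals in [y3], [s3], [y4] and [s4] leave as a function of
    [y = y2] at time [s = s2]. *)
Definition tail_profile (s y : R) : R :=
  interval_integral (fun r => kconv (q (r - s)) (inner_source r) y) s t.

Lemma measurable_inner_source : measurable_fun setT (fun z : R * R => inner_source z.1 z.2).
Proof.
apply: measurable_funM => //; apply: measurable_funM; first exact: measurableT_comp.
apply: measurable_funB; last exact: measurableT_comp.
apply: (@measurable_kconv R _ (R * R)%type (fun z => q (t - z.1)) (fun _ => b) (fun z => z.2)).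
- apply: (measurable_comp2 (@measurable_heat_kernel R)) => //.
  by apply: measurable_funB => //; exact: measurableT_comp.
- exact: measurableT_comp.
- exact: measurable_snd.
Qed.

Lemma measurable_inner_source_at r : measurable_fun setT (inner_source r).
Proof. exact: (measurable_fun_pair2 _ measurable_inner_source). Qed.

Lemma inner_source_le r y : `|inner_source r y| <= 4 * M ^+ 2.
Proof.
rewrite /inner_source normrM (ger0_norm (ler0n _ 2)) normrM.
have h : `|kconv (q (t - r)) b y| <= M.
  by rewrite -[M]mulr1; exact: kconv_le (L1_kernel_heat (t - r)) mb bM y.
have h2 : `|kconv (q (t - r)) b y - b y| <= 2 * M.
  by rewrite (le_trans (ler_normB _ _))// mulr2n mulrDl mul1r lerD.
have -> : 4 * M ^+ 2 = 2 * (M * (2 * M)) by ring.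
by rewrite ler_wpM2l// ler_pM.
Qed.

Lemma measurable_kconv_inner :
  measurable_fun setT (fun z : (R * R) * R => kconv (q (z.2 - z.1.1)) (inner_source z.2) z.1.2).
Proof.
apply: (@measurable_kconv R _ (R * R * R)%type (fun z => q (z.2 - z.1.1))
  (fun z => inner_source z.2) (fun z => z.1.2)).
- apply: (measurable_comp2 (@measurable_heat_kernel R)) => //.
  apply: measurable_funB; first exact: measurableT_comp.
  by apply: (measurableT_comp measurable_fst); exact: (measurableT_comp measurable_fst).
- apply: (measurable_comp2 measurable_inner_source) => //.
  exact: measurableT_comp.
- by apply: (measurableT_comp measurable_snd).
Qed.

Lemma kconv_inner_le s r y : `|kconv (q (r - s)) (inner_source r) y| <= 4 * M ^+ 2.
Proof.
rewrite -[4 * M ^+ 2]mulr1.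
exact: kconv_le (L1_kernel_heat (r - s)) (measurable_inner_source_at r) (inner_source_le r) y.
Qed.

Lemma measurable_tail_profile :
  measurable_fun setT (fun z : R * R => tail_profile z.1 z.2).
Proof.
under eq_fun do rewrite /tail_profile interval_integralE.
apply: (@measurable_Rintegral_snd _ _ _ _ _ mu (fun z : (R * R) * R =>
  between z.1.1 t z.2 * kconv (q (z.2 - z.1.1)) (inner_source z.2) z.1.2)).
apply: measurable_funM; last exact: measurable_kconv_inner.
apply: measurable_between => //.
by apply: (measurableT_comp measurable_fst).
Qed.

Lemma measurable_kconv_inner_r s y :
  measurable_fun setT (fun r : R => kconv (q (r - s)) (inner_source r) y).
Proof. exact: (measurable_fun_pair2 (s, y) measurable_kconv_inner). Qed.

Lemma integrable_kconv_inner s y a c : mu.-integrable setT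
  (EFin \o (fun r => between a c r * kconv (q (r - s)) (inner_source r) y)).
Proof.
apply/interval_integrableE; apply: (@interval_integrable_bounded _ _ _ _ (4 * M ^+ 2)).
  exact: measurable_kconv_inner_r.
by move=> r _ _; exact: kconv_inner_le.
Qed.

Lemma tail_profile_le s y : s <= t -> `|tail_profile s y| <= 4 * M ^+ 2 * (t - s).
Proof.
move=> st; rewrite /tail_profile interval_integralE -Rintegral_between//.
rewrite -RintegralZl//; last exact: integrable_between.
apply: normr_Rintegral_le => //.
- apply: measurable_funM; last exact: measurable_kconv_inner_r.
  exact: measurable_between.
- move=> r _; rewrite normrM mulrC (ger0_norm (between_ge0 _ _ _)).
  by rewrite ler_wpM2r ?between_ge0// kconv_inner_le.
- have := integrableZl measurableT (4 * M ^+ 2) (integrable_between s t).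
  by apply: eq_integrable.
Qed.

(** For [r > s2] the two integrands differ by the action of
    [q (r - s1) - q (r - s2)], of mass at most
    [18 * sqrt ((s2 - s1) / (r - s2))], on a source of size [4 * M ^+ 2]; the
    integral over [r] in [(s2, t)] contributes the factor [2 * sqrt t].  On
    [(s1, s2]] only one integrand is present, and it is bounded. *)
Lemma tail_profile_holder s1 s2 y : 0 <= s1 -> s1 < s2 -> s2 < t ->
  `|tail_profile s2 y - tail_profile s1 y| <=
  152 * M ^+ 2 * (Num.sqrt (s2 - s1) * Num.sqrt t).
Proof.
move=> s10 s12 s2t.
have s1t := lt_trans s12 s2t.
have t0 : 0 < t by rewrite (le_lt_trans s10).
set dl := s2 - s1; have dl0 : 0 < dl by rewrite subr_gt0.
have M20 : 0 <= M ^+ 2 by exact: sqr_ge0.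
have [isq Isq] := inv_sqrt_integral s2t.
pose k r := (Num.sqrt (r - s2))^-1.
pose g1 r := 72 * M ^+ 2 * Num.sqrt dl * (between s2 t r * k r).
(* The interval of [g2] is longer than [(s1, s2]] so as to contain the
   point [s2]; this only doubles its length. *)
pose g2 r := 4 * M ^+ 2 * between s1 (s2 + dl) r.
have ik := (interval_integrableE _ _ _).1 isq.
have ig1 : mu.-integrable setT (EFin \o g1).
  have := integrableZl measurableT (72 * M ^+ 2 * Num.sqrt dl) ik.
  by apply: eq_integrable.
have ig2 : mu.-integrable setT (EFin \o g2).
  have := integrableZl measurableT (4 * M ^+ 2) (integrable_between s1 (s2 + dl)).
  by apply: eq_integrable.
have ig : mu.-integrable setT (EFin \o (fun r => g1 r + g2 r)).
  by have := integrableD measurableT ig1 ig2; apply: eq_integrable.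
have Kp := integrable_kconv_inner.
rewrite /tail_profile !interval_integralE -RintegralB//.
apply: (@le_trans _ _ (\int[mu]_r (g1 r + g2 r))).
  apply: normr_Rintegral_le => //.
    by apply: measurable_funB; apply: measurable_funM;
      by [exact: measurable_between|exact: measurable_kconv_inner_r].
  move=> r _; rewrite /g1 /g2.
  have [s1r|rs1] := ltP s1 r; last first.
    rewrite /between [s2 < r]ltNge (le_trans rs1 (ltW s12)) [s1 < r]ltNge rs1 /=.
    by rewrite !mul0r !mulr0 subr0 addr0 normr0.
  have [s2r|rs2] := ltP s2 r; last first.
    have -> : between s2 t r = 0 by rewrite /between ltNge rs2.
    have -> : between s1 (s2 + dl) r = 1.
      by rewrite between_in// (le_lt_trans rs2)// ltrDl.
    rewrite !mul0r !mulr0 sub0r add0r mulr1 normrN normrM.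
    rewrite -[leRHS]mul1r ler_pM//; last exact: kconv_inner_le.
    by rewrite ger0_norm ?between_ge0// between_le1.
  have [rt|tr] := ltP r t; last first.
    rewrite /between [r < t]ltNge tr /= !andbF !mul0r subr0 normr0 mulr0 add0r.
    by rewrite !mulr_ge0.
  rewrite (between_in s1r rt) (between_in s2r rt) !mul1r.
  have rs2 : 0 < r - s2 by rewrite subr_gt0.
  have rs12 : r - s2 < r - s1 by rewrite ltrD2l ltrN2.
  rewrite distrC.
  rewrite -(kconv_kB y (L1_kernel_heat (r - s1)) (L1_kernel_heat (r - s2))
     (measurable_inner_source_at r) (inner_source_le r)).
  have := kconv_le (L1_kernel_heat_diff rs2 rs12)
    (measurable_inner_source_at r) (inner_source_le r) y.
  have -> : r - s1 - (r - s2) = dl by rewrite /dl; ring.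
  move/le_trans; apply.
  have -> : 4 * M ^+ 2 * (18 * Num.sqrt (dl / (r - s2))) = 72 * M ^+ 2 * Num.sqrt dl * k r.
    rewrite sqrtrM ?ltW// /k -sqrtrV ?ltW//; ring.
  by rewrite lerDl !mulr_ge0// between_ge0.
rewrite RintegralD// /g1 /g2 !RintegralZl//; last exact: integrable_between.
rewrite Rintegral_between; last by rewrite /dl; lra.
rewrite -(interval_integralE k).
have sd0 : 0 <= Num.sqrt dl by exact: sqrtr_ge0.
have st0 : 0 <= Num.sqrt t by exact: sqrtr_ge0.
have st2 : Num.sqrt (t - s2) <= Num.sqrt t.
  by rewrite ler_sqrt ?ltW//; lra.
have sdt : Num.sqrt dl <= Num.sqrt t.
  by rewrite ler_sqrt ?ltW// /dl; lra.
have h1 : 72 * M ^+ 2 * Num.sqrt dl * interval_integral k s2 t <=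
          144 * M ^+ 2 * (Num.sqrt dl * Num.sqrt t).
  have -> : 144 * M ^+ 2 * (Num.sqrt dl * Num.sqrt t) =
     72 * M ^+ 2 * Num.sqrt dl * (2 * Num.sqrt t) by ring.
  rewrite ler_wpM2l ?mulr_ge0//; apply: le_trans Isq _.
  by rewrite ler_wpM2l.
have h2 : 4 * M ^+ 2 * (s2 + dl - s1) <= 8 * M ^+ 2 * (Num.sqrt dl * Num.sqrt t).
  have -> : 4 * M ^+ 2 * (s2 + dl - s1) = 8 * M ^+ 2 * (Num.sqrt dl * Num.sqrt dl).
    by rewrite -expr2 sqr_sqrtr ?ltW// /dl; ring.
  by rewrite ler_wpM2l ?mulr_ge0// ler_wpM2l.
by apply: (le_trans (lerD h1 h2)); rewrite le_eqVlt; apply/orP; left; apply/eqP; ring.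
Qed.

End profile.

(** * The iterated integral *)

Section J5_estimate.
Variables (R : realType) (b : R -> R) (M t : R).
Hypotheses (mb : measurable_fun setT b) (bM : forall y, `|b y| <= M).
Local Notation mu := (@lebesgue_measure R).
Local Notation mu2 := (sigma_finite_product mu mu).
Local Notation mu3 := (sigma_finite_product mu2 mu).
Local Notation q := (@heat_kernel R).
Local Notation q2 := (@heat_kernel2 R).
Local Notation g := (inner_source b t).
Local Notation H := (tail_profile b t).

Let M0 : 0 <= M. Proof. by apply: le_trans (bM 0). Qed.

(** The factors of the integrand that involve only the first one, two or three
    space variables. *)
Definition weight1 (s1 y1 : R) : R := b y1 * q s1 y1.

Definition weight2 (s1 s2 : R) (y : R * R) : R :=
  weight1 s1 y.1 * (b y.2 * q2 (s2 - s1) (y.2 - y.1)).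

Definition weight3 (s1 s2 s3 : R) (y : R * R * R) : R :=
  weight2 s1 s2 y.1 * (b y.2 * q (s3 - s2) (y.2 - y.1.2)).

Lemma measurable_weight1 : measurable_fun setT (fun z : R * R => weight1 z.1 z.2).
Proof.
apply: measurable_funM; first exact: measurableT_comp.
exact: measurable_heat_kernel.
Qed.

Lemma integrable_weight1 s1 : mu.-integrable setT (EFin \o weight1 s1).
Proof.
have := kconv_integrable (L1_kernel_heat s1) mb bM 0.
by apply: eq_integrable => // y _ /=; rewrite subr0.
Qed.

Lemma norm_weight1_le s1 : \int[mu]_y `|weight1 s1 y| <= M.
Proof.
have := Rintegral_norm_kconv_le (L1_kernel_heat s1) mb bM 0.
by under eq_Rintegral do rewrite subr0; rewrite mulr1.
Qed.

Lemma weight1_pairing_le s1 (psi : R -> R) c : measurable_fun setT psi ->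
  (forall y, `|psi y| <= c) -> `|\int[mu]_y (weight1 s1 y * psi y)| <= c * M.
Proof.
move=> mpsi psic.
have c0 : 0 <= c by apply: le_trans (psic 0).
have h := normr_Rintegral_weighted_comp_le (integrable_weight1 s1)
  (@measurable_id _ _ setT) mpsi psic.
by apply: (le_trans h); rewrite ler_wpM2l// norm_weight1_le.
Qed.

Lemma integrable_weight2 s1 s2 : s1 < s2 ->
  mu2.-integrable setT (EFin \o weight2 s1 s2).
Proof.
rewrite -subr_gt0 => s12.
exact: (backward_step_integrable (integrable_weight1 s1) (@measurable_id _ _ setT)
  (L1_kernel_heat2 s12) mb bM).
Qed.

Lemma integrable_weight3 s1 s2 s3 : s1 < s2 ->
  mu3.-integrable setT (EFin \o weight3 s1 s2 s3).
Proof.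
move=> s12.
exact: (backward_step_integrable (integrable_weight2 s12) measurable_snd
  (L1_kernel_heat (s3 - s2)) mb bM).
Qed.

Lemma J5_integrandE s1 s2 s3 s4 : s1 < s2 -> s3 < s4 ->
  J5_integrand b s1 s2 s3 s4 =
  (fun z => weight3 s1 s2 s3 z.1 * (b z.2 * q2 (s4 - s3) (z.2 - z.1.2))).
Proof.
rewrite -subr_gt0 => s12; rewrite -subr_gt0 => s34.
apply/funext => -[[[y1 y2] y3] y4] /=.
rewrite /J5_integrand (heat_kernel''E s12) (heat_kernel''E s34).
by rewrite /weight3 /weight2 /weight1 /=; ring.
Qed.

Lemma J5_integrand_integrable s1 s2 s3 s4 : s1 < s2 -> s3 < s4 ->
  (lebesgue_measure4 R).-integrable setT (EFin \o J5_integrand b s1 s2 s3 s4).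
Proof.
move=> s12 s34; rewrite (J5_integrandE s12 s34); move: s34; rewrite -subr_gt0 => s34.
exact: (backward_step_integrable (integrable_weight3 s3 s12) measurable_snd
  (L1_kernel_heat2 s34) mb bM).
Qed.

Lemma J5_spaceE s1 s2 s3 s4 : s1 < s2 -> s3 < s4 ->
  J5_space b s1 s2 s3 s4 =
  \int[mu3]_y (weight3 s1 s2 s3 y * kconv (q2 (s4 - s3)) b y.2).
Proof.
move=> s12 s34; rewrite /J5_space (J5_integrandE s12 s34).
move: s34; rewrite -subr_gt0 => s34.
exact: (backward_step_integral (integrable_weight3 s3 s12) measurable_snd
  (L1_kernel_heat2 s34) mb bM).
Qed.

(** The exceptional set is a cylinder over [N]. *)
Lemma null_snd N : measurable N -> mu N = 0%E ->
  mu3 ((@snd (R * R) R) @^-1` N) = 0%E.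
Proof.
move=> mN N0.
have -> : (@snd (R * R) R) @^-1` N = setT `*` N by apply/seteqP; split => -[x y] //= [].
have := @product_measure1E _ _ _ _ R mu2 mu setT N measurableT mN.
by rewrite [X in (_ * X)%E]N0 mule0.
Qed.

(** The limit produced by [improper_cvg_heat2] contains [b y3], the factor of
    [weight3] that completes [inner_source]; integrating out [y3] then leaves
    two space variables. *)
Lemma J5_space_improper s1 s2 s3 : s1 < s2 -> s3 < t ->
  improper_cvg (J5_space b s1 s2 s3) s3 t
    (\int[mu2]_y (weight2 s1 s2 y * kconv (q (s3 - s2)) (g s3) y.2)).
Proof.
move=> s12 s3t.
have i3 := integrable_weight3 s3 s12.
rewrite -(backward_step_integral (integrable_weight2 s12) measurable_snd
  (L1_kernel_heat (s3 - s2)) (measurable_inner_source_at t mb s3) (inner_source_le t mb bM s3)).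
have h := improper_cvg_heat2 i3 measurable_snd null_snd mb bM s3t.
have := improper_cvg_eq (fun r s3r _ => esym (J5_spaceE s12 s3r)) h.
congr (improper_cvg _ _ _ _); apply: eq_Rintegral => y _.
by rewrite /weight3 /inner_source /=; ring.
Qed.

Lemma J5_ds4E s1 s2 s3 : s1 < s2 -> s3 < t ->
  J5_ds4 b t s1 s2 s3 =
  \int[mu2]_y (weight2 s1 s2 y * kconv (q (s3 - s2)) (g s3) y.2).
Proof. by move=> s12 s3t; apply: improper_cvg_integral; exact: J5_space_improper. Qed.

Lemma measurable_kconv_inner_pair s2 :
  measurable_fun setT (fun z : R * R => kconv (q (z.1 - s2)) (g z.1) z.2).
Proof.
apply: (measurableT_comp (measurable_kconv_inner t mb)
  (_ : measurable_fun setT (fun z : R * R => ((s2, z.2), z.1)))).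
by apply: measurable_fun_pair => //; apply: measurable_fun_pair.
Qed.

Lemma J5_ds4_integrable s1 s2 : s1 < s2 -> interval_integrable (J5_ds4 b t s1 s2) s2 t.
Proof.
move=> s12; pose F r := kconv (q (r - s2)) (g r).
apply: (@interval_integrable_eq _ _ _
  (fun r => \int[mu2]_y (weight2 s1 s2 y * F r y.2))).
  by move=> r _ rt; rewrite J5_ds4E.
have i2 := integrable_weight2 s12.
apply: (@interval_integrable_bounded _ _ _ _
   (4 * M ^+ 2 * \int[mu2]_y `|weight2 s1 s2 y|)).
  exact: (time_space_measurable i2 measurable_snd (F := F) (measurable_kconv_inner_pair s2)).
move=> r _ _; apply: (normr_Rintegral_weighted_comp_le i2 measurable_snd).
  exact: (measurable_fun_pair2 _ (measurable_kconv_inner_pair s2)).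
by move=> y; exact: kconv_inner_le.
Qed.

(** The function on which the second derivative at time [s2 - s1] acts. *)
Definition source (s y : R) : R := b y * H s y.

Lemma measurable_source : measurable_fun setT (fun z : R * R => source z.1 z.2).
Proof.
apply: measurable_funM; first exact: measurableT_comp.
exact: measurable_tail_profile.
Qed.

Lemma measurable_source_at s : measurable_fun setT (source s).
Proof. exact: (measurable_fun_pair2 _ measurable_source). Qed.

Lemma source_le s y : s <= t -> `|source s y| <= 4 * M ^+ 3 * (t - s).
Proof.
move=> st; rewrite normrM.
have -> : 4 * M ^+ 3 * (t - s) = M * (4 * M ^+ 2 * (t - s)) by ring.
by rewrite ler_pM//; exact: tail_profile_le.
Qed.

Lemma J5_ds3E s1 s2 : s1 < s2 -> s2 < t ->
  J5_ds3 b t s1 s2 = \int[mu]_y (weight1 s1 y * kconv (q2 (s2 - s1)) (source s2) y).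
Proof.
move=> s12 s2t; pose F r := kconv (q (r - s2)) (g r).
have i2 := integrable_weight2 s12.
have M20 : 0 <= 4 * M ^+ 2 by rewrite mulr_ge0// sqr_ge0.
rewrite /J5_ds3 (@interval_integral_eq _ _ _ _
  (fun r => \int[mu2]_y (weight2 s1 s2 y * F r y.2))); last first.
  by move=> r _ rt; rewrite J5_ds4E.
rewrite (time_space_fubini i2 measurable_snd M20 (F := F)
  (measurable_kconv_inner_pair s2)); last first.
  by move=> r y _ _; exact: kconv_inner_le.
have s12' : 0 < s2 - s1 by rewrite subr_gt0.
have := backward_step_integral (integrable_weight1 s1) (@measurable_id _ _ setT)
  (L1_kernel_heat2 s12') (measurable_source_at s2) (fun y => source_le y (ltW s2t)).
move=> <-; apply: eq_Rintegral => y _.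
by rewrite /weight2 /source /tail_profile /=; ring.
Qed.

(** The contribution of the source kept at its value at time [s1], in closed
    form after integration in [s2]. *)
Definition initial_part (s1 : R) : R :=
  \int[mu]_y (weight1 s1 y * (2 * (kconv (q (t - s1)) (source s1) y - source s1 y))).

(** The contribution at time [r = s2] of the increment of the source since
    time [s1]. *)
Definition increment (s1 r : R) : R :=
  \int[mu]_y (weight1 s1 y * kconv (q2 (r - s1)) (fun z => source r z - source s1 z) y).

Lemma measurable_increment :
  measurable_fun setT (fun z : R * R => increment z.1 z.2).
Proof.
apply: (@measurable_Rintegral_snd _ _ _ _ _ mu (fun z : (R * R) * R =>
  weight1 z.1.1 z.2 * kconv (q2 (z.1.2 - z.1.1)) (fun x => source z.1.2 x - source z.1.1 x) z.2)).
have m11 : measurable_fun setT (fun z : R * R * R => z.1.1).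
  by apply: (measurableT_comp measurable_fst).
have m12 : measurable_fun setT (fun z : R * R * R => z.1.2).
  by apply: (measurableT_comp measurable_snd).
have m111 : measurable_fun setT (fun z : R * R * R * R => z.1.1.1).
  exact: (measurableT_comp m11).
have m112 : measurable_fun setT (fun z : R * R * R * R => z.1.1.2).
  exact: (measurableT_comp m12).
apply: measurable_funM; first exact: (measurable_comp2 measurable_weight1).
apply: (@measurable_kconv R _ (R * R * R)%type (fun z => q2 (z.1.2 - z.1.1))
   (fun z => (fun x => source z.1.2 x - source z.1.1 x)) (fun z => z.2)).
- apply: (measurable_comp2 (@measurable_heat_kernel2 R)) => //.
  exact: measurable_funB.
- by apply: measurable_funB; exact: (measurable_comp2 measurable_source).
- exact: measurable_snd.
Qed.

Lemma measurable_initial_part : measurable_fun setT initial_part.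
Proof.
apply: (@measurable_Rintegral_snd _ _ _ _ _ mu (fun z : R * R =>
  weight1 z.1 z.2 * (2 * (kconv (q (t - z.1)) (source z.1) z.2 - source z.1 z.2)))).
apply: measurable_funM; first exact: measurable_weight1.
apply: measurable_funM => //; apply: measurable_funB; last exact: measurable_source.
apply: (@measurable_kconv R _ (R * R)%type (fun z => q (t - z.1))
   (fun z => source z.1) (fun z => z.2)).
- apply: (measurable_comp2 (@measurable_heat_kernel R)) => //.
  by apply: measurable_funB => //; exact: (measurableT_comp measurable_fst).
- apply: (measurable_comp2 measurable_source) => //.
  exact: (measurableT_comp measurable_fst).
- exact: measurable_snd.
Qed.

Lemma initial_part_le s1 : 0 <= s1 -> s1 < t -> `|initial_part s1| <= 16 * M ^+ 4 * t.
Proof.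
move=> s10 s1t.
have psc y := @source_le s1 y (ltW s1t).
have c0 : 0 <= 4 * M ^+ 3 * (t - s1) by apply: le_trans (psc 0).
have mk : measurable_fun setT (fun y => kconv (q (t - s1)) (source s1) y).
  apply: measurable_kconv_snd; last exact: measurable_source_at.
  exact: (measurable_fun_pair2 _ (@measurable_heat_kernel R)).
apply: (@le_trans _ _ (16 * M ^+ 3 * t * M)).
  apply: weight1_pairing_le.
    apply: measurable_funM; first exact: measurable_cst.
    exact: (measurable_funB mk (measurable_source_at s1)).
  move=> y; rewrite normrM ger0_norm//.
  have k1 := kconv_le (L1_kernel_heat (t - s1)) (measurable_source_at s1) psc y.
  rewrite mulr1 in k1.
  have k2 : `|kconv (q (t - s1)) (source s1) y - source s1 y| <= 8 * M ^+ 3 * (t - s1).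
    apply: le_trans (ler_normB _ _) _; apply: le_trans (lerD k1 (psc y)) _.
    by rewrite le_eqVlt; apply/orP; left; apply/eqP; ring.
  have k3 : 8 * M ^+ 3 * (t - s1) <= 8 * M ^+ 3 * t.
    by rewrite ler_wpM2l ?mulr_ge0 ?exprn_ge0//; lra.
  lra.
by rewrite le_eqVlt; apply/orP; left; apply/eqP; ring.
Qed.

(** The Hoelder bound contributes [sqrt (r - s1)], the mass of the second
    derivative [8 / (r - s1)]. *)
Lemma increment_le s1 r : 0 <= s1 -> s1 < r -> r < t ->
  `|increment s1 r| <= 1216 * M ^+ 4 * Num.sqrt t * (Num.sqrt (r - s1))^-1.
Proof.
move=> s10 s1r rt.
have rs0 : 0 < r - s1 by rewrite subr_gt0.
have sr0 : 0 < Num.sqrt (r - s1) by rewrite sqrtr_gt0.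
pose c := 152 * M ^+ 3 * (Num.sqrt (r - s1) * Num.sqrt t).
have dc y : `|source r y - source s1 y| <= c.
  rewrite /source -mulrBr normrM.
  have -> : c = M * (152 * M ^+ 2 * (Num.sqrt (r - s1) * Num.sqrt t)) by rewrite /c; ring.
  by apply: ler_pM => //; exact: tail_profile_holder.
have md := measurable_funB (measurable_source_at r) (measurable_source_at s1).
have k2 := L1_kernel_heat2 rs0.
have mk : measurable_fun setT
    (fun y => kconv (q2 (r - s1)) (fun z => source r z - source s1 z) y).
  apply: measurable_kconv_snd; last exact: md.
  exact: (measurable_fun_pair2 _ (@measurable_heat_kernel2 R)).
apply: le_trans (weight1_pairing_le s1 mk (kconv_le k2 md dc)) _.
rewrite le_eqVlt; apply/orP; left; apply/eqP.
rewrite /c -{2}(sqr_sqrtr (ltW rs0)); field; by rewrite gt_eqF.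
Qed.

Lemma increment_integrable s1 : 0 <= s1 -> s1 < t ->
  interval_integrable (increment s1) s1 t.
Proof.
move=> s10 s1t; have [isq _] := inv_sqrt_integral s1t.
have mi : measurable_fun setT (increment s1).
  exact: (measurable_fun_pair2 _ measurable_increment).
apply: (@dominated_integrable _ _ _ mu _ _
  (fun r => 1216 * M ^+ 4 * Num.sqrt t * (Num.sqrt (r - s1))^-1)) => //.
- exact: measurable_funS mi.
- by move=> r /=; rewrite in_itv/= => /andP[s1r rt]; exact: increment_le.
- have := integrableZl (mu := mu) (measurable_itv _) (1216 * M ^+ 4 * Num.sqrt t) isq.
  by apply: eq_integrable.
Qed.

(** The integral of [1 / sqrt (r - s1)] is at most [2 * sqrt t]. *)
Lemma increment_integral_le s1 : 0 <= s1 -> s1 < t ->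
  `|interval_integral (increment s1) s1 t| <= 2432 * M ^+ 4 * t.
Proof.
move=> s10 s1t; have [isq Isq] := inv_sqrt_integral s1t.
have t0 : 0 < t by exact: le_lt_trans s1t.
have mi : measurable_fun setT (increment s1).
  exact: (measurable_fun_pair2 _ measurable_increment).
have K0 : 0 <= 1216 * M ^+ 4 * Num.sqrt t.
  apply: mulr_ge0; last exact: sqrtr_ge0.
  by apply: mulr_ge0; [exact: ler0n|exact: exprn_ge0].
apply: (@le_trans _ _ (\int[mu]_(r in `]s1, t[)
    (1216 * M ^+ 4 * Num.sqrt t * (Num.sqrt (r - s1))^-1))).
  apply: normr_Rintegral_le => //.
  - exact: measurable_funS mi.
  - by move=> r /=; rewrite in_itv/= => /andP[s1r rt]; exact: increment_le.
  - have := integrableZl (mu := mu) (measurable_itv _) (1216 * M ^+ 4 * Num.sqrt t) isq.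
    by apply: eq_integrable.
rewrite RintegralZl//.
apply: (@le_trans _ _ (1216 * M ^+ 4 * Num.sqrt t * (2 * Num.sqrt t))).
  rewrite ler_wpM2l//; apply: le_trans Isq _; rewrite ler_wpM2l//.
  by rewrite ler_sqrt ?(ltW t0)//; lra.
rewrite le_eqVlt; apply/orP; left; apply/eqP.
rewrite -[in RHS](sqr_sqrtr (ltW t0)); ring.
Qed.

Lemma J5_ds3_improper s1 : 0 <= s1 -> s1 < t ->
  improper_cvg (J5_ds3 b t s1) s1 t
    (initial_part s1 + interval_integral (increment s1) s1 t).
Proof.
move=> s10 s1t.
have nid N : measurable N -> mu N = 0%E -> mu (id @^-1` N) = 0%E by [].
have psc y := @source_le s1 y (ltW s1t).
have h1 := improper_cvg_heat2 (integrable_weight1 s1) (@measurable_id _ _ setT)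
  nid (measurable_source_at s1) psc s1t.
have h2 := improper_cvg_abs (increment_integrable s10 s1t).
apply: improper_cvg_eq (improper_cvgD h1 h2) => r s1r rt /=.
rewrite (J5_ds3E s1r rt) /increment.
have rs0 : 0 < r - s1 by rewrite subr_gt0.
have k2 := L1_kernel_heat2 rs0.
have psr y := @source_le r y (ltW rt).
have mk phi : measurable_fun setT phi ->
    measurable_fun setT (fun y => kconv (q2 (r - s1)) phi y).
  move=> mphi; apply: measurable_kconv_snd; last exact: mphi.
  exact: (measurable_fun_pair2 _ (@measurable_heat_kernel2 R)).
have i1 := integrable_weighted_comp (integrable_weight1 s1) (@measurable_id _ _ setT)
  (mk _ (measurable_source_at s1)) (kconv_le k2 (measurable_source_at s1) psc).
have i2 := integrable_weighted_comp (integrable_weight1 s1) (@measurable_id _ _ setT)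
  (mk _ (measurable_source_at r)) (kconv_le k2 (measurable_source_at r) psr).
have -> : \int[mu]_y (weight1 s1 y *
                kconv (q2 (r - s1)) (fun z => source r z - source s1 z) y) =
  \int[mu]_y (weight1 s1 y * kconv (q2 (r - s1)) (source r) y -
              weight1 s1 y * kconv (q2 (r - s1)) (source s1) y).
  apply: eq_Rintegral => y _; rewrite -mulrBr.
  by rewrite (kconv_phiB y k2 (measurable_source_at r) psr (measurable_source_at s1) psc).
by rewrite (RintegralB measurableT i2 i1) addrC subrK.
Qed.

Lemma J5_ds2E s1 : 0 <= s1 -> s1 < t ->
  J5_ds2 b t s1 = initial_part s1 + interval_integral (increment s1) s1 t.
Proof. by move=> s10 s1t; apply: improper_cvg_integral; exact: J5_ds3_improper. Qed.

(** Closed form of [J5_ds2] on the interval of integration. *)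
Definition time_density (s1 : R) : R := initial_part s1 + interval_integral (increment s1) s1 t.

Lemma measurable_time_density : measurable_fun setT time_density.
Proof.
apply: measurable_funD; first exact: measurable_initial_part.
under eq_fun do rewrite interval_integralE.
apply: (@measurable_Rintegral_snd _ _ _ _ _ mu (fun z : R * R =>
  between z.1 t z.2 * increment z.1 z.2)).
apply: measurable_funM; last exact: measurable_increment.
exact: measurable_between.
Qed.

Lemma time_density_le s1 : 0 <= s1 -> s1 < t -> `|time_density s1| <= 2448 * M ^+ 4 * t.
Proof.
move=> s10 s1t; apply: le_trans (ler_normD _ _) _.
apply: le_trans (lerD (initial_part_le s10 s1t) (increment_integral_le s10 s1t)) _.
by rewrite le_eqVlt; apply/orP; left; apply/eqP; ring.
Qed.

Lemma J5_ds2_integrable : interval_integrable (J5_ds2 b t) 0 t.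
Proof.
apply: (@interval_integrable_eq _ _ _ time_density).
  by move=> r r0 rt; rewrite J5_ds2E// ltW.
apply: (@interval_integrable_bounded _ _ _ _ (2448 * M ^+ 4 * t)).
  exact: measurable_time_density.
by move=> r r0 rt; apply: time_density_le; [exact: ltW|].
Qed.

Lemma J5_le : 0 <= t -> `|J5 b t| <= 2448 * M ^+ 4 * t ^+ 2.
Proof.
move=> t0; rewrite /J5 (@interval_integral_eq _ _ _ _ time_density); last first.
  by move=> r r0 rt; rewrite J5_ds2E// ltW.
have -> : 2448 * M ^+ 4 * t ^+ 2 = 2448 * M ^+ 4 * t * (t - 0) by ring.
rewrite interval_integralE -Rintegral_between//.
rewrite -RintegralZl//; last exact: integrable_between.
apply: normr_Rintegral_le; first exact: measurableT.
- apply: measurable_funM; last exact: measurable_time_density.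
  exact: measurable_between.
- move=> r _; rewrite normrM (ger0_norm (between_ge0 _ _ _)) mulrC /between.
  case: ltP => [r0|_]; last by rewrite !mulr0.
  case: ltP => [rt|_]; last by rewrite !mulr0.
  by rewrite !mulr1; apply: time_density_le; [exact: ltW|].
- have := integrableZl measurableT (2448 * M ^+ 4 * t) (integrable_between 0 t).
  by apply: eq_integrable.
Qed.

Lemma J5_well_definedP : J5_well_defined b t.
Proof.
split.
- by move=> s1 s2 s3 s4 _ s12 _ s34 _; exact: J5_integrand_integrable.
- by move=> s1 s2 s3 _ s12 _ s3t; apply: improper_cvg_integrable; exact: J5_space_improper.
- by move=> s1 s2 _ s12 _; exact: J5_ds4_integrable.
- move=> s1 s10 s1t; apply: improper_cvg_integrable; apply: J5_ds3_improper => //.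
  exact: ltW.
- exact: J5_ds2_integrable.
Qed.

End J5_estimate.

Lemma normr_le_sup_norm (R : realType) (b : R -> R) (x : R) :
  bounded_fun b -> `|b x| <= sup_norm b.
Proof.
move=> [A [_ hA]]; apply: ub_le_sup; last by exists x.
exists (`|A| + 1) => _ [y _ <-]; apply: hA => //.
by rewrite (le_lt_trans (ler_norm _))// ltrDl.
Qed.

Theorem proposition4p2 (R : realType) :
  exists C4 : R, 0 < C4 /\
    forall b : R -> R, measurable_fun setT b -> bounded_fun b ->
    forall t : R, 0 < t ->
      J5_well_defined b t /\
      `|J5 b t| <= C4 * sup_norm b ^+ 4 * t ^+ 2.
Proof.
(* 2448 = 16 + 2432, from the initial part and the increment of the source. *)
exists 2448; split; first by rewrite ltr0n.
move=> b mb bb t t0.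
have bM y := normr_le_sup_norm y bb.
split; first exact: J5_well_definedP mb bM.
exact: J5_le mb bM (ltW t0).
Qed.
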